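(* In the setting described in the context, assume the following. (1) For $m$-a.e. $\sigma$, the deterministic system has a compact pullback attractor $\mathcal A(\sigma)\subset H$ that is invariant, $\Phi_{0,t,\sigma}\mathcal A(\sigma)=\mathcal A(\beta_t\sigma)$ for $t\ge0$, and pullback attracts every bounded set: $\lim_{t\to\infty}\sup_{u\in B}\operatorname{dist}(\Phi_{0,t,\beta_{-t}\sigma}u,\mathcal A(\sigma))=0$ for every bounded $B\subset H$. (2) For each $\varepsilon\in(0,1]$ the stochastic system has a unique stationary measure $\{\mu^\varepsilon_\sigma\}_{\sigma\in\Sigma}$, and it satisfies the trajectory Freidlin–Wentzell uniform LDP on $C([0,T];H)$ with rate function $I^\sigma_{u_0,T}$, for every $T>0$ and time symbol $\sigma\in\Sigma$. (3) (Compact level sets) For $m$-a.e. $\sigma$ and each $M>0$, the set $K_M(\sigma):=\{u\in H:E_{\mathcal A(\sigma)}(u)\le M\}$ is compact in $H$. (4) (Tracking property) For any $\delta,\delta',M>0$ there is a measurable $\eta=\eta(\sigma)\in(0,\delta)$ such that for $m$-a.e. $\sigma$ and all $t>0$, $$\Big\{u(t):u\in C([0,t];H),\ u(0)\in\mathcal A_{\eta(\beta_{-t}\sigma)}(\beta_{-t}\sigma),\ I^{\beta_{-t}\sigma}_{u(0),t}(u)\le M-\delta'\Big\}\subset\mathcal N_\delta(K_M(\sigma)).$$ (5) (Nontrivial escaping energy) For any $R,T>0$ there is a finite measurable $C_{R,T}:\Sigma\to[1,\infty)$ such that for $m$-a.e. $\sigma$, every $u_0\in B_R$ and every admissible control $\varphi\in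 L^2(0,T;H)$, $$\big\|\Phi^{\varphi}_{0,T,\beta_{-T}\sigma}u_0-\Phi_{0,T,\beta_{-T}\sigma}u_0\big\|^2\le C_{R,T}(\sigma)\,J^{\beta_{-T}\sigma}_{u_0,T}(\varphi).$$ (6) (Weak exponential tightness) $\lim_{R\to\infty}\limsup_{\varepsilon\to0}\varepsilon\ln\mu_\sigma^\varepsilon(B_R^c)=-\infty$ for $m$-a.e. $\sigma$. Then for $m$-a.e. $\sigma\in\Sigma$ the family $\{\mu_\sigma^\varepsilon\}_{\varepsilon\in(0,1]}$ satisfies $$\limsup_{\varepsilon\to0}\varepsilon\ln\mu_\sigma^\varepsilon(F)\le-\inf_{u\in F}E_{\mathcal A(\sigma)}(u)\qquad\text{for any closed }F\subset H.$$ If moreover the attractor of the deterministic system is a random point (that is, $\mathcal A(\sigma)=\{a(\sigma)\}$ is a singleton), then for $m$-a.e. $\sigma$ also $$\liminf_{\varepsilon\to0}\varepsilon\ln\mu_\sigma^\varepsilon(G)\ge-\inf_{u\in G}E_{\mathcal A(\sigma)}(u)\qquad\text{for any open }G\subset H.$$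
   Context: $(\Sigma,\beta_t,m)$ is an ergodic invertible measure-preserving flow on a standard Borel probability space. $H$ is a separable Hilbert space with norm $\|\cdot\|$; $B_R$ is the ball of radius $R$ centred at $0$ and $B_\eta(u_* )$ the open ball centred at $u_*$. For each $\sigma$, the deterministic equation $\partial_tu=F(\beta_t\sigma,u)$, $u(0)=u_0$, is assumed well-posed in $H$, with solution map $\Phi_{0,t,\sigma}$. For $\varepsilon\in(0,1]$ the stochastic equation $$\partial_tu=F(\beta_t\sigma,u)+\sqrt\varepsilon\,Q(\beta_t\sigma)\partial_tW,\qquad u(0)=u_0,$$ is assumed well-posed in $H$ with solution map $\Phi^\varepsilon_{0,t,\sigma}$; here $W$ is a two-sided cylindrical Wiener process in $H$ over the canonical Wiener space, $Q(\sigma):H\to H$ is Hilbert–Schmidt for each $\sigma$, and $\sigma\mapsto\|Q(\sigma)\|_{\mathrm{HS}}^2\in L^1(\Sigma,m)$. Its transition operators are $P^\varepsilon_{0,t,\sigma}\phi(u)=\mathbf E\,\phi(\Phi^\varepsilon_{0,t,\sigma}u)$ for bounded measurable $\phi$. A stationary measure is a family $\{\mu_\sigma^\varepsilon\}_{\sigma\in\Sigma}$ of Borel probability measures on $H$ with $\mu_\sigma^\varepsilon P^\varepsilon_{0,t,\sigma}=\mu^\varepsilon_{\beta_t\sigma}$ for $t\ge0$. Controlled equation: for $\varphi\in L^2_{\mathrm{loc}}(\mathbb R;H)$, $\Phi^\varphi_{0,t,\sigma}u_0$ is the solution of $\partial_tu=F(\beta_t\sigma,u)+Q(\beta_t\sigma)\varphi$,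 $u(0)=u_0$. For $u\in C([0,T];H)$, $$I^\sigma_{u(0),T}(u)=\inf_\varphi J^\sigma_{u(0),T}(\varphi),\qquad J^\sigma_{u(0),T}(\varphi)=\tfrac12\int_0^T\|\varphi(s)\|^2ds,$$ the infimum over $\varphi\in L^2(0,T;H)$ with $u(t)=\Phi^\varphi_{0,t,\sigma}u(0)$ for all $t\in[0,T]$ ($=\infty$ if there is none). Quasipotential: for $u_*\in H$, $$E_{\mathcal A(\sigma)}(u_* )=\lim_{\eta\to0}\inf\{I^{\beta_{-s}\sigma}_{u(0),s}(u):s>0,\ u\in C([0,s];H),\ u(0)\in\mathcal A(\beta_{-s}\sigma),\ u(s)\in B_\eta(u_* )\}\in[0,\infty].$$ $\mathcal A_\eta(\sigma)$ is the $\eta$-neighborhood of $\mathcal A(\sigma)$ and $\mathcal N_\delta(K)$ the $\delta$-neighborhood of $K$. Uniform LDP (for given $T>0$, $\sigma$): let $\nu^\varepsilon_{u_0,\sigma}$ be the law of $\Phi^\varepsilon_{0,\cdot,\sigma}u_0$ on $C([0,T];H)$. The uniform LDP holds with rate function $I^\sigma_{u_0,T}$ (restricted to paths starting from $u_0$) if for every $R>0$, $M\ge0$, $\delta,\delta'>0$ there is $\varepsilon_0>0$ such that for all $\varepsilon\in(0,\varepsilon_0]$: (a) $\inf_{\|u_0\|\le R}\inf_{\xi\in\{I^\sigma_{u_0,T}\le M\}}\big(\nu^\varepsilon_{u_0,\sigma}(\mathcal N_{\delta'}(\xi))-e^{-(I^\sigma_{u_0,T}(\xi)+\delta)/\varepsilon}\big)\ge0$;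 (b) $\sup_{\|u_0\|\le R}\nu^\varepsilon_{u_0,\sigma}\big(C([0,T];H)\setminus\mathcal N_{\delta'}(I^\sigma_{u_0,T},M)\big)\le e^{-(M-\delta)/\varepsilon}$. Here $\mathcal N_{\delta'}(\xi)$ and $\mathcal N_{\delta'}(I^\sigma_{u_0,T},M)$ are the $\delta'$-neighborhoods in $C([0,T];H)$ of $\xi$ and of the level set $\{I^\sigma_{u_0,T}\le M\}$.
   Formalization: Added to (6): for each R, σ ↦ limsup_{ε→0} ε ln μ^ε_σ(B_R^c) is m-a.e. equal to a measurable function (otherwise changing μ^ε on ε-dependent null sets breaks the claim); σ ↦ Φ_{0,t,σ}u is measurable; uniqueness of the stationary measure is m-a.e. *)

(* Defs.v *)
From HB Require Import structures.
From mathcomp Require Export all_boot all_order all_algebra.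
From mathcomp Require Export all_classical all_reals all_analysis.
From mathcomp Require Export measurable_realfun.

Set Implicit Arguments.
Unset Strict Implicit.
Unset Printing Implicit Defensive.

Export Order.TTheory GRing.Theory Num.Theory.
Export numFieldNormedType.Exports.

#[global] Open Scope classical_set_scope.
#[global] Open Scope ring_scope.

(** ** Separable Hilbert spaces *)

Notation borel H := (g_sigma_algebraType (@open H)).

Section Hilbert.
Context {R : realType} {H : completeNormedModType R}.
Implicit Types (ip : H -> H -> R) (A B : set H).

(* [ip] is an inner product inducing the (complete) norm of [H]. *)
Definition inner_product ip :=
  [/\ forall a x y z, ip (a *: x + y) z = a * ip x z + ip y z,
      forall x y, ip x y = ip y x &
      forall x, ip x x = `|x| ^+ 2].

Definition separable := exists2 A : set H, countable A & dense A.

Definition orthonormal_basis ip B :=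
  (forall x y, B x -> B y -> ip x y = (x == y)%:R) /\
  (forall x, (forall b, B b -> ip x b = 0) -> x = 0).

Definition hs_norm2 B (q : H -> H) : \bar R :=
  \esum_(b in B) ((`|q b| ^+ 2)%:E).

Definition dist (x : H) A : \bar R := ereal_inf [set (`|x - a|)%:E | a in A].

Definition neighborhood (d : R) A : set H := [set x | (dist x A < d%:E)%E].

Definition closedball (r : R) : set H := [set u | `|u| <= r].

Definition l2norm2 (T : R) (phi : R -> H) : \bar R :=
  (\int[lebesgue_measure]_(s in `[0%R, T]) ((`|phi s| ^+ 2)%R%:E))%E.

Definition L2 (T : R) (phi : R -> H) :=
  measurable_fun `[0, T] (phi : R -> borel H) /\
  (l2norm2 T phi < +oo)%E.

Definition L2loc (phi : R -> H) :=
  measurable_fun setT (phi : R -> borel H) /\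
  forall T : R,
    (\int[lebesgue_measure]_(s in `[(- T)%R, T]) ((`|phi s| ^+ 2)%R%:E) < +oo)%E.

(* [L2(0,T;H)] inside [L2loc(R;H)] *)
Definition ext0 (T : R) (phi : R -> H) : R -> H :=
  fun s => if s \in `[0, T]%R then phi s else 0.

(* [C([0,T];H)], as functions on [R] of which only the restriction to [0,T]
   matters *)
Definition C0 (T : R) : set (R -> H) :=
  [set u | {within `[0, T], continuous u}].

Definition C0dist (T : R) (u v : R -> H) : R :=
  sup [set `|u t - v t| | t in `[0, T]].

End Hilbert.
Arguments separable {R} H.
Arguments C0 {R} H T.

(** ** Probability spaces and flows *)

(* The sigma-algebra is the Borel sigma-algebra of a Polish topology. *)
Definition standard_borel (R : realType) (d : measure_display)
    (S : measurableType d) :=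
  exists rho : S -> S -> R,
    let rho_open (U : set S) :=
      forall x, U x -> exists2 e, 0 < e & forall y, rho x y < e -> U y in
    [/\ forall x y, rho x y = 0 <-> x = y,
        forall x y, rho x y = rho y x,
        forall x y z, rho x z <= rho x y + rho y z &
     [/\ (* completeness *)
         forall x_ : nat -> S,
           (forall e, 0 < e -> exists N, forall i j,
              (N <= i)%N -> (N <= j)%N -> rho (x_ i) (x_ j) < e) ->
           exists x, forall e, 0 < e -> exists N, forall i,
              (N <= i)%N -> rho (x_ i) x < e,
         (* separability *)
         exists2 A : set S, countable A &
           forall x e, 0 < e -> exists2 a, A a & rho x a < e &
         (measurable : set (set S)) = <<s rho_open >>]].

Definition ergodic_flow (R : realType) (d : measure_display)
    (S : measurableType d) (m : probability S R) (beta : R -> S -> S) :=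
  [/\ forall s, beta 0 s = s,
      forall t1 t2 s, beta (t1 + t2) s = beta t1 (beta t2 s),
      measurable_fun setT
        (fun p : R * S => beta p.1 p.2),
      forall t A, measurable A -> m (beta t @^-1` A) = m A &
      forall A, measurable A -> (forall t, beta t @^-1` A = A) ->
        m A = 0%E \/ m A = 1%E].

(* Measurability with respect to the [m]-completion. *)
Definition ae_measurable (R : realType) (d : measure_display)
    (S : measurableType d) (m : probability S R) (f : S -> \bar R) :=
  exists2 g : S -> \bar R, measurable_fun setT g & {ae m, forall s, f s = g s}.

(** ** Cylindrical Wiener processes and Wiener integrals *)

Section Wiener.
Context {R : realType} {H : completeNormedModType R}.
Context {d : measure_display} {Om : measurableType d} (P : probability Om R).
Variable ip : H -> H -> R.

Definition centered_gaussian (v : R) : set R -> \bar R :=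
  if v == 0 then dirac (0 : R) else normal_prob 0 (Num.sqrt v).

(* Covariance of a two-sided Brownian motion vanishing at time 0. *)
Definition bm_cov (s t : R) : R :=
  if (0 <= s) && (0 <= t) then Num.min s t
  else if (s <= 0) && (t <= 0) then Num.min (- s) (- t) else 0.

(* [W t h] stands for <W_t, h>; a cylindrical process in H exists only through
   these scalar components. *)
Definition cylindrical_wiener (W : R -> H -> Om -> R) :=
  [/\ forall t h, measurable_fun setT (W t h),
      forall (n : nat) (c t : 'I_n -> R) (h : 'I_n -> H) (B : set R),
        measurable B ->
        P [set w | B (\sum_(i < n) c i * W (t i) (h i) w)] =
        centered_gaussian
          (\sum_(i < n) \sum_(j < n)
             c i * c j * (bm_cov (t i) (t j) * ip (h i) (h j))) B &
      forall h, {ae P, forall w, continuous (fun t => W t h w)}].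

Definition step_fun (n : nat) (a b : 'I_n -> R) (h : 'I_n -> H) (s : R) : H :=
  \sum_(i < n) (if a i < s <= b i then h i else 0).

Definition step_integral (W : R -> H -> Om -> R)
    (n : nat) (a b : 'I_n -> R) (h : 'I_n -> H) (w : Om) : R :=
  \sum_(i < n) (W (b i) (h i) w - W (a i) (h i) w).

(* [Y] is the Wiener integral of the deterministic integrand [f] over [0,t]:
   an L2(P)-limit of the integrals of step functions converging to [f] in
   L2(0,t;H). By the Ito isometry [Y] is determined up to null sets. *)
Definition wiener_integral (W : R -> H -> Om -> R) (t : R) (f : R -> H)
    (Y : Om -> R) :=
  [/\ measurable_fun setT Y,
      measurable_fun `[0, t] (f : R -> borel H) &
      forall e : R, 0 < e ->
      exists (n : nat) (a b : 'I_n -> R) (h : 'I_n -> H),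
      [/\ forall i, 0 <= a i <= b i /\ b i <= t,
          (l2norm2 t (f \- step_fun a b h)%R <= e%:E)%E &
          (\int[P]_w (((Y w - step_integral W a b h w) ^+ 2)%R%:E)
           <= e%:E)%E]].

End Wiener.

(** ** The equations *)

(* Data of [du/dt = F(beta_t s, u) + Q(beta_t s) (dW/dt)].  The drift takes
   values in a space larger than H (it is typically an unbounded operator), so
   it is given by its pairing [drift s u v] = <F(s,u), v> with test functions
   [v], for [u] in a domain; solutions are weak solutions. *)
Record equation (R : realType) (H : completeNormedModType R) (S : Type) :=
  Equation {
    flow : R -> S -> S;
    test : set H;
    drift_dom : set H;
    drift : S -> H -> H -> R;
    noise : S -> {linear H -> H} }.

Section Equations.
Context {R : realType} {H : completeNormedModType R}.
Context {dS : measure_display} {S : measurableType dS} (m : probability S R).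
Context {dO : measure_display} {Om : measurableType dO} (P : probability Om R).
Variables (ip : H -> H -> R) (W : R -> H -> Om -> R) (eqn : equation H S).

Local Notation leb := (@lebesgue_measure R).
Local Notation beta := (flow eqn).
Local Notation Q := (noise eqn).

Implicit Types (Phi : R -> S -> H -> H) (PhiC : (R -> H) -> R -> S -> H -> H).
Implicit Types (PhiE : R -> R -> S -> H -> Om -> H) (A : S -> set H).
Implicit Types (mu : R -> S -> probability (borel H) R).

Definition noise_HS :=
  exists2 B, orthonormal_basis ip B &
  [/\ forall s, continuous (Q s),
      forall h, measurable_fun setT (fun s => (Q s h : borel H)),
      forall s, (hs_norm2 B (Q s) < +oo)%E &
      m.-integrable setT (fun s => hs_norm2 B (Q s))].

(* [u] solves on [0,T] the equation [du/dt = F(beta_t s, u) + dz/dt],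
   [u(0) = u0], with [zeta t v] = <z(t), v> *)
Definition weak_solution (T : R) (s : S) (u0 : H) (zeta : R -> H -> R)
    (u : R -> H) :=
  [/\ C0 H T u, u 0 = u0,
      {ae leb, forall r, r \in `[0, T] -> drift_dom eqn (u r)} &
      forall v, test eqn v ->
      leb.-integrable `[0, T] (fun r => (drift eqn (beta r s) (u r) v)%:E) /\
      forall t, 0 <= t <= T ->
        ip (u t) v = ip u0 v
          + (\int[leb]_(r in `[0, t]) drift eqn (beta r s) (u r) v)
          + zeta t v].

Definition deterministic_solution T s u0 u :=
  weak_solution T s u0 (fun _ _ => 0) u.

Definition controlled_solution (phi : R -> H) T s u0 u :=
  (forall v, test eqn v ->
     leb.-integrable `[0, T] (fun r => (ip (Q (beta r s) (phi r)) v)%:E)) /\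
  weak_solution T s u0
    (fun t v => \int[leb]_(r in `[0, t]) ip (Q (beta r s) (phi r)) v) u.

(* [sol] is a well-posed problem on every [0,T], with solution map
   [fun t s u0 => Phi t s u0]. *)
Definition solution_map (sol : R -> S -> H -> (R -> H) -> Prop) Phi :=
  [/\ forall s u0 T, 0 < T -> sol T s u0 (fun t => Phi t s u0),
      forall s u0 T u, 0 < T -> sol T s u0 u ->
        forall t, 0 <= t <= T -> u t = Phi t s u0 &
      forall s t, 0 <= t -> continuous (Phi t s)].

Definition deterministic_flow Phi :=
  solution_map deterministic_solution Phi /\
  forall t u0, 0 <= t -> measurable_fun setT (fun s => (Phi t s u0 : borel H)).

Definition controlled_flow PhiC :=
  forall phi, L2loc phi -> solution_map (controlled_solution phi) (PhiC phi).

(* [Z t] is the H-valued stochastic integral of [Q(beta_r s) dW_r] over [0,t];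
   [f] below is [r |-> Q(beta_r s)^* v]. *)
Definition stochastic_integral (s : S) (Z : R -> Om -> H) :=
  (forall w, {within [set t | 0 <= t], continuous (fun t => Z t w)}) /\
  forall t v, 0 <= t ->
  exists2 f : R -> H,
    forall r h, ip (f r) h = ip v (Q (beta r s) h) &
    wiener_integral P W t f (fun w => ip (Z t w) v).

Definition stochastic_solution (eps : R) (Z : R -> Om -> H) T s u0
    (u : R -> Om -> H) :=
  (forall t, 0 <= t <= T -> measurable_fun setT (u t : Om -> borel H)) /\
  {ae P, forall w,
    weak_solution T s u0 (fun t v => Num.sqrt eps * ip (Z t w) v)
      (fun t => u t w)}.

(* [PhiE eps t s u0 w]: existence and pathwise uniqueness. *)
Definition stochastic_flow PhiE :=
  forall eps, 0 < eps <= 1 -> forall s,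
  [/\ forall t, 0 <= t -> measurable_fun setT
        (fun p : borel H * Om => (PhiE eps t s p.1 p.2 : borel H)),
      forall u0 w,
        {within [set t | 0 <= t], continuous (fun t => PhiE eps t s u0 w)} &
      exists2 Z, stochastic_integral s Z &
      forall u0 T, 0 < T ->
        stochastic_solution eps Z T s u0 (fun t => PhiE eps t s u0) /\
        forall u, stochastic_solution eps Z T s u0 u ->
          {ae P, forall w t, 0 <= t <= T -> u t w = PhiE eps t s u0 w}].

(** *** Stationary measures *)

Definition transition PhiE (eps t : R) (s : S)
    (phi : H -> R) (u : H) : R := \int[P]_w phi (PhiE eps t s u w).

Definition stationary PhiE (eps : R) (mu : S -> probability (borel H) R) :=
  (forall B : set (borel H), measurable B ->
     measurable_fun setT (fun s => mu s B)) /\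
  (forall s t (B : set (borel H)), 0 <= t -> measurable B ->
     (\int[mu s]_u ((transition PhiE eps t s \1_B u)%:E) = mu (beta t s) B)%E).

Definition unique_stationary PhiE (eps : R)
    (mu : S -> probability (borel H) R) :=
  stationary PhiE eps mu /\
  forall nu, stationary PhiE eps nu ->
    {ae m, forall s (B : set (borel H)), measurable B -> nu s B = mu s B}.

(** *** Action functional, quasipotential, large deviations *)

Definition cost (T : R) (phi : R -> H) : \bar R :=
  ((2^-1)%:E * l2norm2 T phi)%E.

(* I^s_{u(0),T}(u) *)
Definition action PhiC (s : S) (T : R)
    (u : R -> H) : \bar R :=
  ereal_inf [set cost T phi | phi in
    [set phi | L2 T phi /\
       forall t, 0 <= t <= T -> u t = PhiC (ext0 T phi) t s (u 0)]].

Definition quasipotential PhiC A (s : S) (ustar : H) : \bar R :=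
  lim ((ereal_inf [set y | exists r u,
         [/\ 0 < r, C0 H r u, A (beta (- r) s) (u 0), ball ustar eta (u r) &
             y = action PhiC (beta (- r) s) r u]]) @[eta --> 0^'+]).

Definition sublevel PhiC A s (M : R) : set H :=
  [set u | (quasipotential PhiC A s u <= M%:E)%E].

(* {I^s_{u0,T} <= M} *)
Definition action_level PhiC (s : S) (T : R) (u0 : H) (M : R) : set (R -> H) :=
  [set xi | [/\ C0 H T xi, xi 0 = u0 & (action PhiC s T xi <= M%:E)%E]].

Definition path_law PhiE (eps : R) (s : S) (u0 : H) (A : set (R -> H)) :
    \bar R := P [set w | A (fun t => PhiE eps t s u0 w)].

Definition uniform_LDP PhiC PhiE (s : S) (T : R) :=
  forall r M del del' : R, 0 < r -> 0 <= M -> 0 < del -> 0 < del' ->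
  exists2 eps0 : R, 0 < eps0 <= 1 & forall eps, 0 < eps <= eps0 ->
    (forall u0 xi, `|u0| <= r -> action_level PhiC s T u0 M xi ->
       ((expR (- (fine (action PhiC s T xi) + del) / eps))%:E <=
        path_law PhiE eps s u0 [set u | (C0dist T u xi < del')%R])%E) /\
    (forall u0, `|u0| <= r ->
       (path_law PhiE eps s u0
          (~` [set u | exists2 xi, action_level PhiC s T u0 M xi &
                 (C0dist T u xi < del')%R]) <=
        (expR (- (M - del) / eps))%:E)%E).

(** *** The hypotheses on the attractor and on the stationary measures *)

Definition pullback_attractor Phi A :=
  {ae m, forall s,
    [/\ compact (A s),
        forall t, 0 <= t -> Phi t s @` A s = A (beta t s) &
        forall B : set H, bounded_set B -> B !=set0 ->
          ereal_sup [set dist (Phi t (beta (- t) s) u) (A s) | u in B]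
            @[t --> +oo] --> 0%E]}.

Definition compact_sublevels PhiC A :=
  {ae m, forall s, forall M : R, 0 < M -> compact (sublevel PhiC A s M)}.

Definition tracking PhiC A :=
  forall del del' M : R, 0 < del -> 0 < del' -> 0 < M ->
  exists eta : S -> R,
  [/\ measurable_fun setT eta,
      forall s, 0 < eta s < del &
      {ae m, forall s, forall t, 0 < t -> forall u, C0 H t u ->
         neighborhood (eta (beta (- t) s)) (A (beta (- t) s)) (u 0) ->
         (action PhiC (beta (- t) s) t u <= (M - del')%:E)%E ->
         neighborhood del (sublevel PhiC A s M) (u t)}].

Definition escaping_energy Phi PhiC :=
  forall r T : R, 0 < r -> 0 < T ->
  exists C : S -> R,
  [/\ measurable_fun setT C,
      forall s, 1 <= C s &
      {ae m, forall s, forall u0 phi, closedball r u0 -> L2 T phi ->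
         ((`|PhiC (ext0 T phi) T (beta (- T) s) u0
             - Phi T (beta (- T) s) u0| ^+ 2)%:E <=
          (C s)%:E * cost T phi)%E}].

(* eps * ln (mu^eps_s B), with [ln 0 = -oo] *)
Definition log_mass mu (s : S)
    (B : set H) (eps : R) : \bar R := (eps%:E * lne (mu eps s B))%E.

Definition tail_rate mu (r : R) (s : S) : \bar R :=
  limf_esup (log_mass mu s (~` closedball r)) 0^'+.

(* For fixed [r] the rate is a limsup over uncountably many [eps], which
   stationarity for each single [eps] does not make measurable in [s]. *)
Definition weak_exponential_tightness mu :=
  (forall r, ae_measurable m (tail_rate mu r)) /\
  {ae m, forall s, tail_rate mu r s @[r --> +oo] --> -oo%E}.

End Equations.

(* Main.v *)
(* Write s_t for the symbol [beta (- t) s].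

   Upper bound.  By stationarity mu_s(F) is the probability that a solution started
   at time -t from mu_{s_t} lies in F at time 0.  By measure preservation alone,
   almost every s admits arbitrarily many well separated integer times n_1 < n_2 < ...
   for which one radius r, one segment length T, one escape constant and one tracking
   width eta0 are valid on every segment [-n_j - T, -n_j]: the masses of the
   complement of the r-ball at time -n_j - T are at most exp(-M/eps), and Phi maps
   the (r+1)-ball at time -n_j - T into the eta0/2-neighborhood of the attractor at
   time -n_j.  Up to an event of probability of order exp(-M/eps) the solution is thus
   in the r-ball at all the times -n_j - T and, by the LDP, uniformly close to a path
   of action at most M - del'.  If that path missed the tracked neighborhood of the
   attractor at every time -n_j, each segment would cost a fixed energy, which is
   impossible with enough segments; hence tracking applies at some -n_j and puts the
   endpoint near K_M(s), away from F.

   Lower bound.  A nearly optimal path leaving the attractor at time -r is preceded by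
   the uncontrolled evolution on [-K, -r].  Pullback attraction to the random point
   and continuity of the controlled flow make all these paths, started at time -K
   from anywhere in a ball carrying at least half of the mass of mu_{s_K}, end near
   the same target, so that the uniform LDP lower bound integrates. *)
Require Import Defs.
From mathcomp Require Import lra ring.

Set Implicit Arguments.
Unset Strict Implicit.
Unset Printing Implicit Defensive.

(** * Borel sets of separable normed spaces *)

Lemma invS_lt (R : realType) (e : R) : 0 < e ->
  exists k : nat, k.+1%:R^-1 < e.
Proof.
move=> e0; have [k _ /(_ k)] := near_infty_natSinv_lt (PosNum e0).
by move=> /(_ (leqnn k)) /= ke; exists k.
Qed.

Section BorelNormed.
Context {R : realType} {H : completeNormedModType R}.

Lemma open_borel (U : set H) : open U -> measurable (U : set (borel H)).
Proof. by move=> oU; exact: sub_sigma_algebra. Qed.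

Lemma closed_borel (U : set H) : closed U -> measurable (U : set (borel H)).
Proof.
by move=> cU; rewrite -[U]setCK; apply: measurableC; apply: open_borel; rewrite openC.
Qed.

Lemma continuous_borel (f : H -> R) : continuous f ->
  measurable_fun setT (f : borel H -> R).
Proof.
move=> cf; apply: (measurability _ (RGenOInfty.measurableE R)) => _ [_ [x ->] <-].
rewrite setTI; apply: open_borel; move/continuousP : cf; apply.
exact: interval_open.
Qed.

Lemma measurable_norm_sub (d : measure_display) (T : measurableType d)
    (D : set T) (X : T -> H) (c : H) : measurable_fun D (X : T -> borel H) ->
  measurable_fun D (fun w => `|X w - c|).
Proof.
move=> mX.
have : measurable_fun setT ((fun x => `|x - c|) : borel H -> R).
  apply: continuous_borel => x; apply: cvg_norm; apply: cvgB; first exact: cvg_id.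
  exact: cvg_cst.
by move=> /measurableT_comp; apply.
Qed.

Lemma measurable_norm_sqr (d : measure_display) (T : measurableType d)
    (D : set T) (X : T -> H) : measurable_fun D (X : T -> borel H) ->
  measurable_fun D (fun w => ((`|X w| ^+ 2)%R%:E)).
Proof.
move=> /(measurable_norm_sub 0) mX; apply/measurable_EFinP.
have -> : (fun w => `|X w| ^+ 2) = (fun x => x ^+ 2) \o (fun w => `|X w - 0|).
  by apply/funext => w /=; rewrite subr0.
by apply: measurableT_comp.
Qed.

Lemma measurable_ball_preimage (d : measure_display) (T : measurableType d)
    (X : T -> H) (c : H) (r : R) : measurable_fun setT (X : T -> borel H) ->
  measurable [set w | `|X w - c| <= r].
Proof.
move=> /(measurable_norm_sub c) mX.
have -> : [set w | `|X w - c| <= r] =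
    [set: T] `&` (fun w => `|X w - c|) @^-1` `]-oo, r]%classic.
  by rewrite setTI; apply/seteqP; split => w /=; rewrite in_itv.
exact: mX.
Qed.

Lemma measurable_closedball (r : R) : measurable (closedball r : set (borel H)).
Proof.
have := measurable_ball_preimage 0 r (@measurable_id _ (borel H) setT).
by congr measurable; apply/seteqP; split => w; rewrite /closedball /= subr0.
Qed.

Lemma separable_enum : separable H -> exists f : nat -> H,
  forall x e, 0 < e -> exists i, `|x - f i| < e.
Proof.
move=> [A cA dA].
have [f fA] : exists f : nat -> H, A `<=` range f.
  have /countable_injP[g ginj] := cA.
  (* Where [g] misses a value the sequence takes the default [0], possibly outside [A]; only the
     inclusion of [A] in the range is claimed. *)
  exists (fun n => xget 0 [set x | A x /\ g x = n]) => x Ax.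
  exists (g x) => //; case: xgetP => [y _ [Ay gy]|/(_ x)/= []//].
  by apply: ginj => //; rewrite inE.
exists f => x e e0.
have [y []] := dA (ball x e) (ex_intro _ x (ballxx x e0)) (ball_open x e).
by rewrite -ball_normE /= => xy /fA[i _ fi]; exists i; rewrite fi.
Qed.

(** The event is split along a dense sequence: [X w] is close to [f i], and [Y w] lies within the
    remaining distance of [f i]. Each piece involves only distances to a fixed point, and
    separability makes the union countable. *)
Lemma measurable_dist_lt (d : measure_display) (T : measurableType d)
    (X Y : T -> H) (r : R) : separable H ->
  measurable_fun setT (X : T -> borel H) ->
  measurable_fun setT (Y : T -> borel H) ->
  measurable [set w | `|X w - Y w| < r].
Proof.
move=> /separable_enum[f fd] mX mY.
have -> : [set w | `|X w - Y w| < r] =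
  \bigcup_i \bigcup_k ([set w | `|X w - f i| <= k.+1%:R^-1] `&`
     [set w | `|Y w - f i| < r - k.+1%:R^-1]).
  apply/seteqP; split => w /=; last first.
    move=> [i _ [k _ [/= Xi Yi]]].
    rewrite -(subrKA (f i)) (le_lt_trans (ler_normD _ _)) //.
    by have := ler_ltD Xi Yi; rewrite [X in _ < X]addrC subrK [X in _ + X]distrC.
  move=> XY.
  (* Half of the slack, because the mesh is spent twice: on approximating [X w] by [f i], and on
     shrinking the radius around [f i]. *)
  have [k kr] := invS_lt (divr_gt0 (eqbRL (subr_gt0 _ _) XY) (ltr0Sn R 1)).
  have k0 : 0 < (k.+1%:R^-1 : R) by rewrite invr_gt0.
  have [i Xi] := fd (X w) _ k0.
  exists i => //; exists k => //; split => /=; first exact: ltW.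
  rewrite -(subrKA (X w)) (le_lt_trans (ler_normD _ _)) // distrC.
  move: kr Xi; move: (k.+1%:R^-1 : R) `|X w - Y w| `|X w - f i| => /= a b c.
  lra.
apply: bigcupT_measurable => i; apply: bigcupT_measurable => k.
apply: measurableI; first exact: measurable_ball_preimage.
have -> : [set w | `|Y w - f i| < r - k.+1%:R^-1] =
    [set: T] `&` (fun w => `|Y w - f i|) @^-1` `]-oo, r - k.+1%:R^-1[%classic.
  by rewrite setTI; apply/seteqP; split => w /=; rewrite in_itv.
exact: measurable_norm_sub.
Qed.

End BorelNormed.

(** * Translations of Lebesgue integrals *)

Section LebesgueTranslation.
Context {R : realType}.
Local Notation leb := (@lebesgue_measure R).
Implicit Types (a : R) (D : set R).

Lemma measurable_translation a :
  measurable_fun setT ((fun x => a + x) : measurableTypeR R -> measurableTypeR R).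
Proof. by apply: measurable_funD. Qed.

Definition translated_lebesgue a : {measure set (measurableTypeR R) -> \bar R} :=
  measure_function_pushforward__canonical__measure_function_Measure
    leb (measurable_translation a).

(** Lebesgue measure is determined by its values on half-open intervals, whose lengths a translation
    preserves. *)
Lemma translated_lebesgueE a D : measurable D -> translated_lebesgue a D = leb D.
Proof.
move=> mD; apply/esym/lebesgue_measure_unique => //.
move=> X [[x y] _ <-]; rewrite /= /pushforward.
rewrite (_ : _ @^-1` _ = `]x - a, y - a]%classic); last first.
  by apply/seteqP; split => z /=; rewrite !in_itv/= ltrBlDl lerBrDl.
rewrite !lebesgue_measure_itv/= !lte_fin ltrD2r.
by case: ifP => // _; rewrite -EFinB -EFinB; congr EFin; ring.
Qed.

Lemma negligible_translation a D : leb.-negligible D ->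
  leb.-negligible ((fun x => a + x) @^-1` D).
Proof.
move=> [N [mN N0 DN]]; exists ((fun x => a + x) @^-1` N); split.
- by rewrite -[_ @^-1` _]setTI; exact: measurable_translation.
- by have := translated_lebesgueE a mN; rewrite N0.
- by move=> x; exact: DN.
Qed.

Lemma ge0_integral_translation a D (f : R -> \bar R) : measurable D ->
  measurable_fun D f -> (forall x, D x -> 0 <= f x)%E ->
  (\int[leb]_(x in D) f x =
   \int[leb]_(x in (fun x => (a + x)%R) @^-1` D) f (a + x)%R)%E.
Proof.
move=> mD mf f0.
rewrite -(@ge0_integral_pushforward _ _ _ _ _ _ (measurable_translation a) leb D f) //.
  apply: (eq_measure_integral (translated_lebesgue a)) => // B mB BD.
  by rewrite translated_lebesgueE.
by move=> y; rewrite inE; exact: f0.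
Qed.

Lemma measurable_fun_translation (d : measure_display) (T : measurableType d)
    a D (f : R -> T) : measurable D ->
  measurable_fun D f ->
  measurable_fun ((fun x => a + x) @^-1` D) (fun x => f (a + x)).
Proof.
move=> mD mf; apply: (measurable_comp mD) => //.
  by move=> _ [x Dx <-].
exact: measurable_funTS (measurable_translation a).
Qed.

Lemma integral_translation a D (f : R -> \bar R) : measurable D ->
  measurable_fun D f ->
  (\int[leb]_(x in D) f x =
   \int[leb]_(x in (fun x => (a + x)%R) @^-1` D) f (a + x)%R)%E.
Proof.
move=> mD mf; rewrite integralE [RHS]integralE.
congr (_ - _)%E.
- rewrite (@ge0_integral_translation a D f^\+%E) //; last exact/measurable_funepos.
  by apply: eq_integral => x _; rewrite !funeposE.
- rewrite (@ge0_integral_translation a D f^\-%E) //; last exact/measurable_funeneg.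
  by apply: eq_integral => x _; rewrite !funenegE.
Qed.

Lemma integrable_translation a D (f : R -> \bar R) : measurable D ->
  leb.-integrable D f ->
  leb.-integrable ((fun x => a + x) @^-1` D) (fun x => f (a + x)).
Proof.
move=> mD /integrableP[mf fD]; apply/integrableP; split.
  exact: measurable_fun_translation.
rewrite -(@ge0_integral_translation a D (fun x => `|f x|%E)) //.
exact: measurableT_comp.
Qed.

Lemma translation_itvcc a b t :
  (fun x => a + x) @^-1` `[a + b, a + t] = `[b, t]%classic.
Proof. by apply/seteqP; split => x /=; rewrite !in_itv/= !lerD2l. Qed.

Lemma Rintegral_itv_translation a (T t : R) (f : R -> R) : 0 <= a -> 0 <= t <= T ->
  leb.-integrable `[0, a + T] (EFin \o f) ->
  \int[leb]_(x in `[0, a + t]) f x =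
  \int[leb]_(x in `[0, a]) f x + \int[leb]_(x in `[0, t]) f (a + x).
Proof.
move=> a0 /andP[t0 tT] fi.
have fi' : leb.-integrable `[0, a + t] (EFin \o f).
  apply: integrableS fi => //; apply: subset_itvl.
  by rewrite bnd_simp lerD2l.
have /eqP : \int[leb]_(x in `[0, a + t]) f x - \int[leb]_(x in `[0, a]) f x =
    \int[leb]_(x in `]a, a + t]) f x.
  by apply: Rintegral_itvB => //; rewrite bnd_simp // lerDl.
rewrite subr_eq => /eqP ->; rewrite [LHS]addrC; congr (_ + _).
have fi2 : leb.-integrable `]a, a + t] (EFin \o f).
  apply: integrableS fi' => //; apply: subset_itvr.
  by rewrite bnd_simp.
rewrite Rintegral_itv_obnd_cbnd //.
have mfi : measurable_fun `[a, a + t] (EFin \o f).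
  have := measurable_int _ fi'; apply: measurable_funS => //.
  by apply: subset_itvr; rewrite bnd_simp.
rewrite /Rintegral (integral_translation a) //.
by have := translation_itvcc a 0 t; rewrite addr0 => ->.
Qed.

Lemma integrable_itv_translation a (T : R) (f : R -> \bar R) : 0 <= a ->
  leb.-integrable `[0, a + T] f -> leb.-integrable `[0, T] (fun x => f (a + x)).
Proof.
move=> a0 fi; have := translation_itvcc a 0 T; rewrite addr0 => <-.
apply: integrable_translation => //.
by apply: integrableS fi => //; apply: subset_itvr; rewrite bnd_simp.
Qed.

(** The point [0] is null. It is left free because at the junction of two glued controls the value
    belongs to the earlier one. *)
Lemma eq_integrable_itvoc (T : R) (f g : R -> \bar R) : 0 < T ->
  {in `]0, T]%R, f =1 g} -> leb.-integrable `[0, T] f -> leb.-integrable `[0, T] g.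
Proof.
move=> T0 fg fi.
have fi' : leb.-integrable `]0, T] f.
  by apply: integrableS fi => //; apply: subset_itvr; rewrite bnd_simp.
have gi : leb.-integrable `]0, T] g.
  by apply: (eq_integrable _ _ _ _ fi') => // x; rewrite inE => /fg.
have mg := measurable_int _ gi.
apply/integrableP; split.
  have -> : `[0, T]%classic = [set 0] `|` `]0, T]%classic.
    by rewrite setU1itv ?bnd_simp // ltW.
  by apply/measurable_funU => //; split => //; exact: measurable_fun_set1.
rewrite -(@integral_itv_obnd_cbnd _ _ _ (fun x => `|g x|%E)).
  by case/integrableP : gi.
exact: measurableT_comp.
Qed.

Lemma eq_Rintegral_itvoc (T : R) (f g : R -> R) : 0 <= T ->
  {in `]0, T]%R, f =1 g} -> leb.-integrable `[0, T] (EFin \o f) ->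
  \int[leb]_(x in `[0, T]) f x = \int[leb]_(x in `[0, T]) g x.
Proof.
rewrite le_eqVlt => /predU1P[<- _ _|T0 fg fi].
  by rewrite set_itv1 !Rintegral_set1.
have fi' : leb.-integrable `]0, T] (EFin \o f).
  by apply: integrableS fi => //; apply: subset_itvr; rewrite bnd_simp.
have gi : leb.-integrable `]0, T] (EFin \o g).
  by apply: (eq_integrable _ _ _ _ fi') => // x; rewrite inE /= => /fg ->.
rewrite -!Rintegral_itv_obnd_cbnd //.
by apply: eq_Rintegral => x; rewrite inE => /fg.
Qed.

End LebesgueTranslation.

(** * The cocycle property of the controlled flow *)

Lemma C0_translation (R : realType) (H : completeNormedModType R) (a T : R)
    (u : R -> H) : 0 <= a ->
  C0 H (a + T) u -> C0 H T (fun t => u (a + t)).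
Proof.
move=> a0 /subspace_continuousP uc; apply/subspace_continuousP => x xT.
have axT : (a + x)%R \in `[0, a + T]%R.
  by move: xT; rewrite /= !in_itv/= => /andP[x0 xT]; rewrite lerD2l xT addr_ge0.
apply: (cvg_trans _ (uc (a + x) axT)).
move=> A uA.
have ac : (a + z)%R @[z --> x] --> (a + x)%R.
  by apply: cvgD; [exact: cvg_cst|exact: cvg_id].
apply: (@filterS _ (nbhs x) _ _ _ _ (ac _ uA)) => z /= h zT; apply: h.
by move: zT; rewrite /= !in_itv/= => /andP[z0 zT]; rewrite lerD2l zT addr_ge0.
Qed.

Lemma C0S (R : realType) (H : completeNormedModType R) (T T' : R)
    (u : R -> H) : T <= T' -> C0 H T' u -> C0 H T u.
Proof.
by move=> TT'; apply: continuous_subspaceW; apply: subset_itvl; rewrite bnd_simp.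
Qed.

Section Cocycle.
Context {R : realType} {H : completeNormedModType R}.
Context {dS : measure_display} {S : measurableType dS}.
Variables (ip : H -> H -> R) (eqn : equation H S).
Local Notation beta := (flow eqn).
Local Notation leb := (@lebesgue_measure R).
Hypothesis betaD : forall t1 t2 s, beta (t1 + t2) s = beta t1 (beta t2 s).

Lemma ae_translation (a : R) (P Q : R -> Prop) : (forall r, P (a + r) -> Q r) ->
  {ae leb, forall r, P r} -> {ae leb, forall r, Q r}.
Proof.
move=> PQ /(negligible_translation a); apply: negligibleS => r /= nQ Pr.
by apply: nQ; exact: PQ.
Qed.

(** The weak formulation is an integral identity at each time. The identity at time [a] absorbs the
    integrals over [[0, a]] in the one at time [a + t], which leaves the identity for the shifted
    path and symbol. *)
Lemma controlled_solution_translation (phi phi' : R -> H) (a T : R) s u0 u :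
  0 <= a -> 0 < T ->
  (forall r, r \in `]0, T]%R -> phi' r = phi (a + r)) ->
  controlled_solution ip eqn phi (a + T) s u0 u ->
  controlled_solution ip eqn phi' T (beta a s) (u a) (fun t => u (a + t)).
Proof.
move=> a0 T0 phi'E [Qi [uc u00 udom usol]].
have betaC r : beta r (beta a s) = beta (a + r) s by rewrite -betaD addrC.
have Qi' v : test eqn v -> leb.-integrable `[0, T]
    (fun r => (ip (noise eqn (beta r (beta a s)) (phi' r)) v)%:E).
  move=> tv; apply: (@eq_integrable_itvoc _ _ _ _ T0 _
    (integrable_itv_translation a0 (Qi v tv))) => //.
  by move=> x /phi'E ->; rewrite betaC.
split=> //; split.
- exact: C0_translation.
- by rewrite addr0.
- apply: (ae_translation _ udom) => r h rT; apply: h.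
  by move: rT; rewrite /= !in_itv/= => /andP[r0 rT]; rewrite lerD2l rT addr_ge0.
- move=> v tv; have [di dsol] := usol v tv; split.
    apply: (@eq_integrable _ _ _ _ _ _ _ _ _
      (integrable_itv_translation a0 di)) => //.
    by move=> x _; rewrite betaC.
  move=> t /andP[t0 tT].
  rewrite dsol; last by rewrite lerD2l tT addr_ge0.
  rewrite (dsol a); last by rewrite a0 lerDl (ltW T0).
  rewrite (@Rintegral_itv_translation _ a T t _ a0 _ di) ?t0 //.
  rewrite (@Rintegral_itv_translation _ a T t _ a0 _ (Qi v tv)) ?t0 //.
  rewrite -!addrA; congr (_ + (_ + _)); rewrite addrCA; congr (_ + (_ + _)).
    by apply: eq_Rintegral => r _; rewrite betaC.
  apply: eq_Rintegral_itvoc => // [r /itvP rt|].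
    by rewrite betaC phi'E // in_itv/= rt (le_trans _ tT) // rt.
  apply: integrableS (integrable_itv_translation a0 (Qi v tv)) => //.
  by apply: subset_itvl; rewrite bnd_simp.
Qed.

End Cocycle.

(** * Square-integrable controls: truncation and translation *)

Section Controls.
Context {R : realType} {H : completeNormedModType R}.
Local Notation leb := (@lebesgue_measure R).
Implicit Types phi : R -> H.

Lemma L2loc0 : L2loc (fun _ : R => 0 : H).
Proof.
split=> [|T]; first exact: measurable_cst.
by rewrite integral0_eq ?ltry // => x _; rewrite normr0 expr0n.
Qed.

Lemma ext0E T phi r : r \in `[0, T]%R -> ext0 T phi r = phi r.
Proof. by rewrite /ext0 => ->. Qed.

(** Any interval is allowed because two cutoffs occur: [ext0] on a closed interval, [delayed] on one
    open at its left end. *)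
Lemma L2loc_restrict (i : interval R) T phi :
  [set` i] `<=` `[0, T]%classic -> L2 T phi ->
  L2loc (fun r => if r \in i then phi r else 0).
Proof.
move=> iT [mphi phioo]; split.
  rewrite -(setUv [set` i]); apply/measurable_funU => //.
    exact: measurableC.
  split.
    apply: (@eq_measurable_fun _ _ _ (borel H) _ phi); last exact: measurable_funS mphi.
    by move=> r; rewrite inE /= => ->.
  apply: (@eq_measurable_fun _ _ _ (borel H) _ (fun=> 0 : H)); last exact: measurable_cst.
  by move=> r; rewrite inE /= => /negP/negbTE ->.
move=> T'.
have -> : (fun s => ((`|if s \in i then phi s else 0| ^+ 2)%R%:E)) =
    (fun s => ((`|phi s| ^+ 2)%R%:E)) \_ [set` i].
  apply/funext => s; rewrite patchE mem_setE.
  by case: ifP => //; rewrite normr0 expr0n.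
rewrite -integral_mkcondr; apply: le_lt_trans phioo.
apply: ge0_subset_integral => //=.
- exact: measurableI.
- exact: measurable_norm_sqr.
- by move=> r [_ /iT].
Qed.

Lemma L2loc_ext0 T phi : L2 T phi -> L2loc (ext0 T phi).
Proof. exact: L2loc_restrict. Qed.

Lemma L2loc_translation a phi : L2loc phi -> L2loc (fun r => phi (a + r)).
Proof.
move=> [mphi phioo]; split.
  have := @measurable_fun_translation _ _ (borel H) a _ _ measurableT mphi.
  by rewrite preimage_setT.
move=> T.
have := translation_itvcc a (- T) T => <-.
rewrite -(@ge0_integral_translation _ a _ (fun s => ((`|phi s| ^+ 2)%R%:E))) //.
  (* The shifted window [[a - T, a + T]] lies in the symmetric window of half-width [|a| + T]. *)
  apply: le_lt_trans (phioo (`|a| + T)).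
  apply: ge0_subset_integral => //=.
    by apply: measurable_funTS; exact: measurable_norm_sqr.
  apply: subset_itv; rewrite bnd_simp ?lerD2r ?ler_norm //.
  by rewrite opprD lerD2r lerNl -normrN ler_norm.
by apply: measurable_funTS; exact: measurable_norm_sqr.
Qed.

Lemma L2_translation a T phi : 0 <= a ->
  L2 (a + T) phi -> L2 T (fun r => phi (a + r)) /\
  (l2norm2 T (fun r => phi (a + r)%R) =
   \int[leb]_(s in `[a, (a + T)%R]) ((`|phi s| ^+ 2)%R%:E))%E.
Proof.
move=> a0 [mphi phioo].
have sub : `[a, a + T]%classic `<=` `[0, a + T]%classic.
  by apply: subset_itvr; rewrite bnd_simp.
have mphi' : measurable_fun `[a, a + T] (phi : R -> borel H).
  exact: measurable_funS mphi.
have := translation_itvcc a 0 T; rewrite addr0 => tE.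
have E : (l2norm2 T (fun r => phi (a + r)%R) =
   \int[leb]_(s in `[a, (a + T)%R]) ((`|phi s| ^+ 2)%R%:E))%E.
  rewrite [RHS](ge0_integral_translation a) //; last exact: measurable_norm_sqr.
  by rewrite tE.
split=> //; split.
  by rewrite -tE; apply: measurable_fun_translation.
rewrite E; apply: le_lt_trans phioo.
by apply: ge0_subset_integral => //=; exact: measurable_norm_sqr.
Qed.

Lemma L2_translation_le a T phi : 0 <= a -> L2 (a + T) phi ->
  (l2norm2 T (fun r => phi (a + r)%R) <= l2norm2 (a + T) phi)%E.
Proof.
move=> a0 phi2; have [_ ->] := L2_translation a0 phi2.
apply: ge0_subset_integral => //=.
  by apply: measurable_norm_sqr; case: phi2.
by apply: subset_itvr; rewrite bnd_simp.
Qed.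

End Controls.

(** * Cocycle identities and delayed controls *)

Section Flows.
Context {R : realType} {H : completeNormedModType R}.
Context {dS : measure_display} {S : measurableType dS}.
Variables (ip : H -> H -> R) (eqn : equation H S).
Hypothesis ip_H : inner_product ip.
Local Notation beta := (flow eqn).
Local Notation leb := (@lebesgue_measure R).
Hypothesis beta0 : forall s, beta 0 s = s.
Hypothesis betaD : forall t1 t2 s, beta (t1 + t2) s = beta t1 (beta t2 s).
Variables (Phi : R -> S -> H -> H) (PhiC : (R -> H) -> R -> S -> H -> H).
Hypothesis Phi_flow : deterministic_flow ip eqn Phi.
Hypothesis PhiC_flow : controlled_flow ip eqn PhiC.

(** The shifted path solves the shifted problem, and well-posedness leaves only one solution. *)
Lemma PhiC_cocycle phi phi' a T s u0 t : 0 <= a -> 0 < T ->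
  L2loc phi -> L2loc phi' ->
  (forall r, r \in `]0, T]%R -> phi' r = phi (a + r)) -> 0 <= t <= T ->
  PhiC phi (a + t) s u0 = PhiC phi' t (beta a s) (PhiC phi a s u0).
Proof.
move=> a0 T0 phi2 phi2' phi'E tT.
have [_ uniq _] := PhiC_flow phi2'; have [sol _ _] := PhiC_flow phi2.
apply: (uniq (beta a s) (PhiC phi a s u0) T (fun t => PhiC phi (a + t) s u0)) => //.
apply: controlled_solution_translation (sol s u0 (a + T) _) => //.
by rewrite ltr_wpDl.
Qed.

Lemma PhiC_at0 phi s u0 : L2loc phi -> PhiC phi 0 s u0 = u0.
Proof.
by move=> /PhiC_flow[sol _ _]; have [_ [_ ->]] := sol s u0 _ ltr01.
Qed.

(** The cocycle identity with [a = 0]: up to time [T] the solution ignores the control at time [0]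
    and beyond [T]. *)
Lemma eq_PhiC phi phi' T s u0 t : 0 < T -> L2loc phi -> L2loc phi' ->
  (forall r, r \in `]0, T]%R -> phi' r = phi r) -> 0 <= t <= T ->
  PhiC phi t s u0 = PhiC phi' t s u0.
Proof.
move=> T0 phi2 phi2' phi'E tT.
have := @PhiC_cocycle phi phi' 0 T s u0 t (lexx _) T0 phi2 phi2'.
rewrite !add0r beta0 PhiC_at0 //; apply => // r rT.
by rewrite add0r phi'E.
Qed.

Lemma PhiC_path phi T s u0 : L2loc phi -> C0 H T (fun t => PhiC phi t s u0).
Proof.
move=> /PhiC_flow[sol _ _].
have T0 : 0 < Num.max T 1 by rewrite lt_max ltr01 orbT.
have [_ [uc _ _ _]] := sol s u0 _ T0.
by apply: C0S uc; rewrite le_max lexx.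
Qed.

Lemma PhiC_zero phi T s u0 t : L2loc phi -> 0 <= t <= T ->
  (forall r, r \in `[0, T]%R -> phi r = 0) ->
  PhiC phi t s u0 = Phi t s u0.
Proof.
move=> phi2 /andP[t0 tT] phi0.
have [ipl _ _] := ip_H.
have ip0 v : ip 0 v = 0.
  by have := ipl (-1) 0 0 v; rewrite scaler0 addr0 mulN1r addNr.
have [[solD uniq _] _] := Phi_flow; have [sol _ _] := PhiC_flow phi2.
(* [solution_map] concerns positive horizons only; for [T <= 0] the time [t] is [0] and both flows
   return the initial point. *)
have [T0|T0] := ltP 0 T; last first.
  have -> : t = 0 by apply/eqP; rewrite eq_le t0 (le_trans tT).
  rewrite PhiC_at0 //.
  by have [_ ->] := solD s u0 _ ltr01.
apply: (uniq s u0 T (fun t => PhiC phi t s u0)) => //; last by rewrite t0.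
have [_ [uc u0E ud usol]] := sol s u0 T T0.
split=> // v tv; have [di dE] := usol v tv; split=> // r /andP[r0 rT].
rewrite dE ?r0 //; congr (_ + _).
transitivity (\int[leb]_(x in `[0, r]) (0 : R)); last first.
  by rewrite Rintegral_cst // mul0r.
apply: eq_Rintegral => x; rewrite inE /= => /itvP xr.
by rewrite phi0 ?linear0 ?ip0 // in_itv/= xr (le_trans _ rT) ?xr.
Qed.

(** The controlled cocycle identity at the zero control. The horizon [t + 1] keeps the interval
    nondegenerate when [t = 0]. *)
Lemma Phi_cocycle a t s u0 : 0 <= a -> 0 <= t ->
  Phi (a + t) s u0 = Phi t (beta a s) (Phi a s u0).
Proof.
move=> a0 t0; have z2 := @L2loc0 R H.
rewrite -!(@PhiC_zero (fun=> 0) (a + t)) ?lexx ?lerDl ?lerDr ?addr_ge0 ?a0 ?t0 //.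
apply: (@PhiC_cocycle _ _ _ (t + 1)) => //; first by rewrite ltr_wpDl.
by rewrite t0 lerDl ler01.
Qed.

Lemma PhiC_continuous phi s t : L2loc phi -> 0 <= t -> continuous (PhiC phi t s).
Proof. by move=> /PhiC_flow[_ _ c] t0; exact: c. Qed.

Lemma Phi_continuous s t : 0 <= t -> continuous (Phi t s).
Proof. by have [[_ _ c] _] := Phi_flow => t0; exact: c. Qed.

(* The interval is open at [0], so that the delayed control vanishes on all of [0,a]. *)
Definition delayed a T (phi : R -> H) (r : R) : H :=
  if - a + r \in `]0, T]%R then phi (- a + r) else 0.

Lemma L2loc_delayed a T phi : L2 T phi -> L2loc (delayed a T phi).
Proof.
move=> phi2; apply: (@L2loc_translation _ _ _ (fun r => if r \in `]0, T]%R then phi r else 0)).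
apply: L2loc_restrict phi2.
by apply: subset_itvr; rewrite bnd_simp.
Qed.

(** The delayed control vanishes on [[0, a]], so the system first follows [Phi]; then [phi] acts
    from its own time [0]. This prepends a free evolution to a controlled path. *)
Lemma PhiC_delayed a T phi s u0 t : 0 <= a -> 0 < T -> L2 T phi -> 0 <= t <= T ->
  PhiC (delayed a T phi) (a + t) s u0 =
  PhiC (ext0 T phi) t (beta a s) (Phi a s u0).
Proof.
move=> a0 T0 phi2 tT.
rewrite (@PhiC_cocycle _ (ext0 T phi) _ T) //; last 3 first.
- exact: L2loc_delayed.
- exact: L2loc_ext0.
- move=> r rT; rewrite /delayed addKr rT ext0E //.
  by apply: subset_itvr rT; rewrite bnd_simp.
congr (PhiC _ _ _ _); apply: (@PhiC_zero _ a); rewrite ?a0 ?lexx //.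
  exact: L2loc_delayed.
move=> r /itvP ra; rewrite /delayed in_itv/= ltNge.
by rewrite addrC subr_le0 ra.
Qed.

Lemma l2norm2_delayed a T phi : 0 <= a -> 0 < T -> L2 T phi ->
  (l2norm2 (a + T) (delayed a T phi) <= l2norm2 T phi)%E.
Proof.
move=> a0 T0 phi2; have [md _] := L2loc_delayed a phi2.
have [mphi _] := phi2.
have -> : l2norm2 (a + T) (delayed a T phi) =
  (\int[leb]_(s in `]a, (a + T)%R]) ((`|delayed a T phi s| ^+ 2)%R%:E))%E.
  rewrite /l2norm2 integral_mkcond [RHS]integral_mkcond; apply: eq_integral => s _.
  rewrite !patchE !mem_setE.
  have [sa|] := boolP (s \in `]a, a + T]).
    by rewrite ifT //; apply: subset_itvr sa; rewrite bnd_simp.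
  move=> sa; rewrite /delayed (_ : (- a + s \in `]0, T]) = false).
    by rewrite normr0 expr0n if_same.
  by apply: contraNF sa; rewrite !in_itv/= [- a + _]addrC subr_gt0 lerBlDl.
have E : `]a, (a + T)%R]%classic = (fun x => - a + x) @^-1` `]0, T]%classic.
  by apply/seteqP; split => x /=; rewrite !in_itv/= [- a + _]addrC subr_gt0 lerBlDl.
rewrite E.
rewrite -(@ge0_integral_translation _ (- a) `]0, T]%classic (fun s => ((`|if s \in `]0, T]%R then phi s else 0| ^+ 2)%R%:E))) //; last first.
  apply: measurable_norm_sqr; apply: (@eq_measurable_fun _ _ _ (borel H) _ phi).
    by move=> r; rewrite inE /= => ->.
  by apply: measurable_funS mphi => //; apply: subset_itvr; rewrite bnd_simp.
apply: (@le_trans _ _ (\int[leb]_(s in `]0%R, T]) ((`|phi s| ^+ 2)%R%:E))%E).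
  by rewrite le_eqVlt; apply/orP; left; apply/eqP; apply: eq_integral => x;
    rewrite inE /= => ->.
apply: ge0_subset_integral => //=; first exact: measurable_norm_sqr.
by apply: subset_itvr; rewrite bnd_simp.
Qed.

End Flows.

(** * Actions of paths *)

Section Neighborhoods.
Context {R : realType} {H : completeNormedModType R}.
Implicit Types (A : set H) (x y : H).

Lemma neighborhoodP (d : R) A x :
  neighborhood d A x <-> exists2 a, A a & `|x - a| < d.
Proof.
split=> [/ereal_inf_lt[_ [a Aa <-]] xa|[a Aa xa]].
  by exists a.
by apply: (@le_lt_trans _ _ (`|x - a|)%:E) => //; apply: ereal_inf_lbound; exists a.
Qed.

Lemma neighborhood_triangle (d e : R) A x y :
  neighborhood d A x -> `|y - x| < e -> neighborhood (d + e) A y.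
Proof.
move=> /neighborhoodP[a Aa xa] yx; apply/neighborhoodP; exists a => //.
by rewrite -(subrKA x) addrC (le_lt_trans (ler_normD _ _)) // ltrD.
Qed.

Lemma neighborhoodW (d e : R) A x : d <= e -> neighborhood d A x -> neighborhood e A x.
Proof.
by move=> de /neighborhoodP[a Aa xa]; apply/neighborhoodP; exists a => //; exact: lt_le_trans de.
Qed.

End Neighborhoods.

Section Energy.
Context {R : realType}.
Local Notation leb := (@lebesgue_measure R).

(** The gap condition on [nu] makes the windows [[t1 - nu j - T, t1 - nu j]] disjoint, so their
    energies add up inside [[0, t1]]. *)
Lemma energy_chain (g : R -> \bar R) (t1 T c : R) (nu : nat -> R) (N : nat) :
  0 <= T -> 0 <= nu 0%N -> 0 <= c ->
  (forall j, nu j + T < nu j.+1) -> (nu N + T <= t1) ->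
  measurable_fun `[0, t1] g -> (forall x, 0 <= g x)%E ->
  (forall j, (j <= N)%N ->
    c%:E <= \int[leb]_(x in `[(t1 - nu j - T)%R, (t1 - nu j)%R]) g x)%E ->
  ((N.+1%:R * c)%:E <= \int[leb]_(x in `[0%R, t1]) g x)%E.
Proof.
move=> T0 nu0 c0 nuS nuN mg g0 cg.
have nuge0 j : 0 <= nu j.
  by elim: j => // j IH; apply: le_trans (ltW (nuS j)); rewrite addr_ge0.
have numono j : (j <= N)%N -> nu j <= nu N.
  move=> jN; apply: (@homo_leq _ nu (fun x y => x <= y)) => //.
    by move=> x y z; exact: le_trans.
  by move=> k; apply: le_trans (ltW (nuS k)); rewrite lerDl.
have mgS a b : 0 <= a -> b <= t1 -> measurable_fun `[a, b] g.
  by move=> a0 bt; apply: measurable_funS mg => //; apply: subset_itv; rewrite bnd_simp.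
(* The induction goes backwards in time: window [j.+1] lies strictly before everything counted so
   far. *)
have key j : (j <= N)%N ->
    ((j.+1%:R * c)%:E <= \int[leb]_(x in `[(t1 - nu j - T)%R, t1]) g x)%E.
  elim: j => [_|j IH jN].
    rewrite mul1r (le_trans (cg 0%N _)) //.
    apply: ge0_subset_integral => //=.
      by apply: mgS => //; have := numono 0%N (leq0n _); lra.
    by apply: subset_itvl; rewrite bnd_simp; lra.
  have nuj := numono _ jN; have := nuS j => nuj'.
  have m1 : measurable (`[t1 - nu j.+1 - T, t1 - nu j.+1]%classic : set R) by [].
  have m2 : measurable (`[t1 - nu j - T, t1]%classic : set R) by [].
  apply: (@le_trans _ _ (\int[leb]_(x in `[(t1 - nu j.+1 - T)%R, (t1 - nu j.+1)%R] `|`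
      `[(t1 - nu j - T)%R, t1]) g x)%E).
    rewrite ge0_integral_setU //.
    - rewrite -[j.+2%:R]natr1 mulrDl mul1r EFinD addeC leeD //.
        exact: cg.
      exact: IH (ltnW jN).
    - apply/measurable_funU => //; split; apply: mgS; have := nuge0 j; have := nuge0 j.+1; lra.
    - apply/disj_setPS => x [] /=; rewrite !in_itv/= => /andP[_ x1] /andP[x2 _].
      lra.
  apply: ge0_subset_integral => //=.
  - exact: measurableU.
  - by apply: mgS; lra.
  - have := nuge0 j; have := nuge0 j.+1.
    by move=> ? ? x [] /=; rewrite !in_itv/= => /andP[x1 x2]; apply/andP; split; lra.
apply: (le_trans (key N (leqnn N))).
apply: ge0_subset_integral => //=.
by apply: subset_itvr; rewrite bnd_simp; lra.
Qed.

End Energy.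

Section Action.
Context {R : realType} {H : completeNormedModType R}.
Context {dS : measure_display} {S : measurableType dS}.
Variables (ip : H -> H -> R) (eqn : equation H S).
Local Notation beta := (flow eqn).
Local Notation leb := (@lebesgue_measure R).
Hypothesis beta0 : forall s, beta 0 s = s.
Hypothesis betaD : forall t1 t2 s, beta (t1 + t2) s = beta t1 (beta t2 s).
Variables (Phi : R -> S -> H -> H) (PhiC : (R -> H) -> R -> S -> H -> H).
Hypothesis PhiC_flow : controlled_flow ip eqn PhiC.
Implicit Types (u : R -> H) (phi : R -> H).

Lemma cost_ge0 T phi : (0 <= cost T phi)%E.
Proof. by apply: mule_ge0; rewrite ?lee_fin ?invr_ge0 //; exact: integral_ge0. Qed.

Lemma action_ge0 s T u : (0 <= action PhiC s T u)%E.
Proof. by apply/ereal_infP => _ [phi _ <-]; exact: cost_ge0. Qed.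

Definition steers s T u phi :=
  L2 T phi /\ forall t, 0 <= t <= T -> u t = PhiC (ext0 T phi) t s (u 0).

Lemma action_le_cost s T u phi : steers s T u phi -> (action PhiC s T u <= cost T phi)%E.
Proof. by move=> h; apply: ereal_inf_lbound; exists phi. Qed.

Lemma steers_translation s a T u phi : 0 <= a -> 0 < T -> steers s (a + T) u phi ->
  steers (beta a s) T (fun t => u (a + t)) (fun r => phi (a + r)).
Proof.
move=> a0 T0 [phi2 uE]; have [phi2' _] := L2_translation a0 phi2.
split=> // t /andP[t0 tT].
rewrite addr0 uE ?addr_ge0 ?lerD2l // (uE a) ?a0 ?lerDl ?(ltW T0) //.
apply: (PhiC_cocycle betaD PhiC_flow _ _ a0 T0) => //.
- exact: L2loc_ext0.
- exact: L2loc_ext0.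
- move=> r /itvP rT; rewrite !ext0E // in_itv/= ?lerD2l ?rT ?addr_ge0 ?rT //.
- by rewrite t0.
Qed.

(** The final stretch of any control for the whole path is admissible for the tail of the path and
    costs no more. *)
Lemma action_translation s a T u : 0 <= a -> 0 < T ->
  (action PhiC (beta a s) T (fun t => u (a + t)%R) <= action PhiC s (a + T) u)%E.
Proof.
move=> a0 T0; apply/ereal_infP => _ [phi hphi <-].
apply: le_trans (action_le_cost (steers_translation a0 T0 hphi)) _.
rewrite /cost lee_pmul2l //.
by apply: L2_translation_le => //; case: hphi.
Qed.

Lemma steers_delayed s a T phi (u0 : H) : 0 <= a -> 0 < T -> L2 T phi ->
  steers s (a + T) (fun t => PhiC (delayed a T phi) t s u0) (delayed a T phi).
Proof.
move=> a0 T0 phi2; have dl2 := L2loc_delayed a phi2.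
have d2 : L2 (a + T) (delayed a T phi).
  split; first by apply: measurable_funTS; case: dl2.
  by apply: le_lt_trans (l2norm2_delayed a0 T0 phi2) _; case: phi2.
split=> // t tT.
rewrite (PhiC_at0 PhiC_flow) //; apply: (eq_PhiC beta0 betaD PhiC_flow (T := a + T)) => //.
- by rewrite ltr_wpDl.
- exact: L2loc_ext0.
- by move=> r /itvP rT; rewrite ext0E // in_itv/= !rT.
Qed.

Lemma action_delayed s a T phi (u0 : H) : 0 <= a -> 0 < T -> L2 T phi ->
  (action PhiC s (a + T) (fun t => PhiC (delayed a T phi) t s u0) <= cost T phi)%E.
Proof.
move=> a0 T0 phi2; apply: le_trans (action_le_cost (steers_delayed _ _ a0 T0 phi2)) _.
by rewrite /cost lee_pmul2l ?l2norm2_delayed.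
Qed.

(* A low-action path which passes through the ball of radius [r] at the times
   [- nu j - T] has to enter the tracked neighborhood of the attractor at one of
   the times [- nu j], each failure costing a fixed amount of energy. *)
Lemma low_action_endpoint (A : S -> set H) (eta : S -> R) (s : S)
    (r T c0 eta0 M M' del : R) (N : nat) (nu : nat -> R) (xi : R -> H) :
  let t1 := nu N + T in
  0 < T -> 1 <= c0 -> 0 < eta0 -> M' < M ->
  M * c0 <= N.+1%:R * (eta0 / 2) ^+ 2 ->
  0 < nu 0%N -> (forall j, nu j + T < nu j.+1) ->
  (forall j, (j <= N)%N -> forall (u0 : H) phi, closedball r u0 -> L2 T phi ->
     ((`|PhiC (ext0 T phi) T (beta (- T) (beta (- nu j) s)) u0
         - Phi T (beta (- T) (beta (- nu j) s)) u0| ^+ 2)%:E <=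
      c0%:E * cost T phi)%E) ->
  (forall j, (j <= N)%N -> forall u0 : H, closedball r u0 ->
     neighborhood (eta0 / 2) (A (beta (- nu j) s))
       (Phi T (beta (- T) (beta (- nu j) s)) u0)) ->
  (forall j, (j <= N)%N -> eta0 <= eta (beta (- nu j) s)) ->
  (forall t, 0 < t -> forall u, C0 H t u ->
     neighborhood (eta (beta (- t) s)) (A (beta (- t) s)) (u 0) ->
     (action PhiC (beta (- t) s) t u <= M'%:E)%E ->
     neighborhood del (sublevel eqn PhiC A s M) (u t)) ->
  C0 H t1 xi -> (action PhiC (beta (- t1) s) t1 xi <= M'%:E)%E ->
  (forall j, (j <= N)%N -> closedball r (xi (t1 - nu j - T))) ->
  neighborhood del (sublevel eqn PhiC A s M) (xi t1).
Proof.
(* The clock of [xi] starts at time [- t1], so its value [t1 - nu j] corresponds to time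
   [- nu j]. *)
move=> t1 T0 c01 eta00 M'M MN nu0 nuS esc attr etaj track xic xiM xir.
have nugt0 j : 0 < nu j.
  by elim: j => // j IH; apply: lt_trans (nuS j); rewrite addr_gt0.
have numono j : (j <= N)%N -> nu j <= nu N.
  move=> jN; apply: (@homo_leq _ nu (fun x y => x <= y)) => //.
    by move=> x y z; exact: le_trans.
  by move=> k; apply: le_trans (ltW (nuS k)); rewrite lerDl ltW.
apply: contrapT => notin.
have M'Me : (M'%:E < M%:E)%E by rewrite lte_fin.
(* The infimum may not be attained; the gap between [M'] and [M] provides one control of cost below
   [M], fixed from here on. *)
have [_ [phi steer <-] phiM] := ereal_inf_lt (le_lt_trans xiM M'Me).
have phi2 : L2 t1 phi by case: steer.
have shiftE a : beta a (beta (- t1) s) = beta (a - t1) s by rewrite -betaD.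
(* Energy of a failed segment: [(eta0 / 2) ^+ 2] is at most [c0] times the cost, and the cost is
   half the squared norm. *)
have seg j : (j <= N)%N -> ((2 * (eta0 / 2) ^+ 2 / c0)%:E <=
    \int[leb]_(x in `[(t1 - nu j - T)%R, (t1 - nu j)%R]) ((`|phi x| ^+ 2)%R%:E))%E.
  move=> jN; have nuj := numono _ jN; have nuj0 := nugt0 j.
  have a0 : 0 <= t1 - nu j - T by rewrite /t1; lra.
  have b0 : 0 <= t1 - nu j by rewrite /t1; lra.
  (* Proximity to the attractor at time [- nu j] would start the tracking on the remaining stretch
     of length [nu j] and give the excluded conclusion. *)
  have far : ~ neighborhood eta0 (A (beta (- nu j) s)) (xi (t1 - nu j)).
    move=> near0; apply: notin.
    have := track (nu j) nuj0 (fun t => xi (t1 - nu j + t)).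
    rewrite subrK; apply.
    - by apply: C0_translation => //; rewrite subrK.
    - by rewrite addr0; apply: neighborhoodW near0; exact: etaj.
    - apply: le_trans xiM; have := action_translation (beta (- t1) s) xi b0 nuj0.
      by rewrite subrK shiftE addrAC subrr sub0r.
  have steerT : steers (beta (- t1) s) (t1 - nu j - T + T) xi phi.
    have [_ phiE] := steer; rewrite subrK; have bt1 : t1 - nu j <= t1 by lra.
    have phi2' : L2 (t1 - nu j) phi.
      have [mphi phioo] := phi2; split.
        by apply: measurable_funS mphi => //; apply: subset_itvl; rewrite bnd_simp.
      apply: le_lt_trans phioo; apply: ge0_subset_integral => //=.
        exact: measurable_norm_sqr.
      by apply: subset_itvl; rewrite bnd_simp.
    split=> // t /andP[t0 tb]; rewrite phiE ?t0 ?(le_trans tb) //.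
    apply: (eq_PhiC beta0 betaD PhiC_flow (T := t1 - nu j)).
    - by rewrite /t1; lra.
    - exact: L2loc_ext0.
    - exact: L2loc_ext0.
    - by move=> z /itvP zb; rewrite !ext0E // in_itv/= ?zb ?(le_trans _ bt1) ?zb.
    - by rewrite t0.
  have [phij2 phijE] := steers_translation a0 T0 steerT.
  have phiT2 : L2 (t1 - nu j - T + T) phi by case: steerT.
  have [_ E] := L2_translation a0 phiT2.
  have := phijE T; rewrite addr0 subrK lexx ltW // => /(_ isT) xiE.
  have rhoE : beta (t1 - nu j - T) (beta (- t1) s) = beta (- T) (beta (- nu j) s).
    by rewrite -!betaD; congr (beta _ s); ring.
  have := esc j jN (xi (t1 - nu j - T)) _ (xir j jN) phij2.
  rewrite -rhoE -xiE /cost E subrK => esc1.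
  (* The free flow ends within [eta0 / 2] of the attractor while the path stays [eta0] away from
     it. *)
  have dist1 : eta0 / 2 <= `|xi (t1 - nu j) -
      Phi T (beta (t1 - nu j - T) (beta (- t1) s)) (xi (t1 - nu j - T))|.
    rewrite leNgt; apply/negP => lt1; apply: far.
    rewrite [eta0]splitr; apply: neighborhood_triangle lt1.
    by rewrite rhoE; apply: attr => //; exact: xir.
  have sqr1 : (((eta0 / 2) ^+ 2)%:E <= c0%:E * (2^-1%:E *
      \int[leb]_(x in `[(t1 - nu j - T)%R, (t1 - nu j)%R]) ((`|phi x| ^+ 2)%R%:E)))%E.
    apply: le_trans esc1; rewrite lee_fin ler_pXn2r // ?nnegrE ?normr_ge0 //.
    by rewrite divr_ge0 // ltW.
  have Efin : (\int[leb]_(x in `[(t1 - nu j - T)%R, (t1 - nu j)%R])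
      ((`|phi x| ^+ 2)%R%:E) \is a fin_num)%E.
    rewrite ge0_fin_numE; last exact: integral_ge0.
    by have [_] := phij2; rewrite E subrK.
  rewrite -(fineK Efin) -!EFinM !lee_fin in sqr1 *.
  by rewrite ler_pdivrMr ?(lt_le_trans ltr01) //; lra.
(* The [N.+1] failed segments force the squared norm of [phi] to be at least [2 * M], against a cost
   below [M]. *)
have := @energy_chain _ (fun x => ((`|phi x| ^+ 2)%R%:E)) t1 T _ nu N (ltW T0)
  (ltW nu0) _ nuS (lexx _) _ _ seg.
have /[swap] /[apply] : 0 <= 2 * (eta0 / 2) ^+ 2 / c0.
  by apply: divr_ge0; [rewrite mulr_ge0 ?sqr_ge0|exact: le_trans ler01 c01].
have /[swap] /[apply] : measurable_fun `[0, t1] (fun x => ((`|phi x| ^+ 2)%R%:E)).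
  by apply: measurable_norm_sqr; case: phi2.
have /[swap] /[apply] : forall x, (0 <= ((`|phi x| ^+ 2)%R%:E : \bar R))%E.
  by move=> x; rewrite lee_fin sqr_ge0.
rewrite -/(l2norm2 t1 phi) => chain.
have normfin : (l2norm2 t1 phi \is a fin_num)%E.
  by rewrite ge0_fin_numE; [case: phi2|exact: integral_ge0].
move: phiM chain; rewrite /cost -(fineK normfin) -EFinM lte_fin lee_fin mulrA.
have c00 : 0 < c0 by apply: lt_le_trans c01.
rewrite ler_pdivrMr // => phiM chain.
have : 2^-1 * fine (l2norm2 t1 phi) * c0 < M * c0 by rewrite ltr_pM2r.
move: MN; lra.
Qed.

End Action.

(** * Measurability of path neighborhoods *)

Section PathSpace.
Context {R : realType} {H : completeNormedModType R}.
Implicit Types (u v : R -> H).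

Lemma C0_norm_sub T u v : C0 H T u -> C0 H T v ->
  {within `[0, T], continuous (fun t => `|u t - v t|)}.
Proof.
move=> uc vc x; apply: cvg_norm; apply: cvgB; [exact: uc|exact: vc].
Qed.

Lemma le_C0dist T u v t : C0 H T u -> C0 H T v -> t \in `[0, T]%R ->
  `|u t - v t| <= C0dist T u v.
Proof.
move=> uc vc tT; have T0 : 0 <= T by move: tT => /itvP h; rewrite h.
(* The extreme value theorem bounds the set of distances, so that its [sup] is an upper bound. *)
have [c _ cmax] := EVT_max T0 (C0_norm_sub uc vc).
apply: ub_le_sup; last by exists t.
by exists (`|u c - v c|) => _ [x /= xT <-]; exact: cmax.
Qed.

Lemma C0dist_le T u v e : 0 <= T ->
  (forall t, t \in `[0, T]%R -> `|u t - v t| <= e) -> C0dist T u v <= e.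
Proof.
move=> T0 h; apply: ge_sup; last by move=> _ [x /= xT <-]; exact: h.
by exists `|u 0 - v 0|; exists 0 => //=; rewrite in_itv/= lexx.
Qed.

(** Compactness of the segment, in its near-covering form, makes the local moduli of continuity
    uniform. *)
Lemma C0_uniform_continuity T u e : C0 H T u -> 0 < e ->
  exists n : nat, forall s t, s \in `[0, T]%R -> t \in `[0, T]%R ->
    `|s - t| <= n.+1%:R^-1 -> `|u s - u t| < e.
Proof.
move=> /subspace_continuousP uc e0.
have e20 : 0 < e / 2 by rewrite divr_gt0.
pose P (n : nat) (x : R) := forall t, t \in `[0, T]%R -> x \in `[0, T]%R ->
  `|t - x| <= n.+1%:R^-1 -> `|u t - u x| < e.
have [|n _ /(_ n (leqnn n)) nP] :=
    (compact_near_coveringP _).1 (@segment_compact R 0 T) nat \oo P _.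
  move=> x xT.
  have /(uc x xT) : nbhs (u x) (ball (u x) (e / 2)) by exact: nbhsx_ballx.
  move=> /nbhs_ballP[r /= r0 rb].
  (* Half of the radius, so that a point at distance below [r / 2] from a [y] near [x] still lies in
     the [r]-ball around [x]. *)
  have r20 : 0 < r / 2 by rewrite divr_gt0.
  have [N Nr] := invS_lt r20.
  exists (ball x (r / 2), [set n | (N <= n)%N]).
    by split; [exact: nbhsx_ballx|exists N].
  move=> [y n] [/= xy Nn] t tT yT ty.
  have nN : (n.+1%:R^-1 : R) <= N.+1%:R^-1 by rewrite lef_pV2 ?posrE // ler_nat.
  have h z : z \in `[0, T]%R -> ball x r z -> `|u x - u z| < e / 2.
    by move=> zT xz; have := rb z xz zT; rewrite -ball_normE.
  have uy := h y yT (le_ball (ltW (_ : r / 2 < r)) xy).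
  have ut : `|u x - u t| < e / 2.
    apply: h => //; move: xy; rewrite -!ball_normE /= => xy.
    rewrite -(subrKA y) (le_lt_trans (ler_normD _ _)) // [`|y - t|]distrC.
    by move: xy ty nN Nr; move: (N.+1%:R^-1 : R) (n.+1%:R^-1 : R) => a b; lra.
  rewrite -(subrKA (u x)) (le_lt_trans (ler_normD _ _)) // distrC [ltRHS]splitr.
  by rewrite ltrD //; apply: uy; lra.
by exists n => s t sT tT st; exact: (nP t tT).
Qed.

Lemma rat_agree T u v e : 0 < T -> C0 H T u -> C0 H T v ->
  (forall q : rat, ratr q \in `[0, T]%R -> `|u (ratr q) - v (ratr q)| <= e) ->
  forall t, t \in `[0, T]%R -> `|u t - v t| <= e.
Proof.
move=> T0 uc vc h t tT; rewrite leNgt; apply/negP => lt_e.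
have /subspace_continuousP/(_ t tT) := C0_norm_sub uc vc.
move=> /(_ _ (open_nbhs_nbhs (conj (@open_gt _ e) lt_e))).
move=> /nbhs_ballP[r /= r0 rb].
(* The bounds [0] and [T] keep the rational inside the segment, where continuity is available. *)
have [q qI] : exists q : rat, ratr q \in `]Num.max 0 (t - r), Num.min T (t + r)[.
  apply: rat_in_itvoo; move: tT; rewrite in_itv/= => /andP[t0 tT].
  by rewrite gt_max !lt_min; apply/andP; split; apply/andP; split; lra.
move: qI; rewrite in_itv/= gt_max lt_min => /andP[/andP[q0 qt] /andP[qT qt']].
have qI : ratr q \in `[0, T]%R by rewrite in_itv/= !ltW.
have tq : ball t r (ratr q).
  by rewrite -ball_normE /= ltr_norml; apply/andP; split; lra.
have : e < `|u (ratr q) - v (ratr q)| := rb _ tq qI.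
by rewrite ltNge h.
Qed.

End PathSpace.

Section PathMeasurability.
Context {R : realType} {H : completeNormedModType R}.
Context {d : measure_display} {Om : measurableType d}.
Variables (X : R -> Om -> H) (T : R).
Hypotheses (sep_H : separable H) (T0 : 0 < T).
Hypothesis mX : forall t, 0 <= t -> measurable_fun setT (X t : Om -> borel H).
Hypothesis cX : forall w, C0 H T (fun t => X t w).

(** The large deviation bounds concern such events for an arbitrary set of paths; comparing and
    adding their probabilities requires measurability. *)
Lemma measurable_path_neighborhood (L : set (R -> H)) (del : R) :
  (forall xi, L xi -> C0 H T xi) ->
  measurable [set w | exists2 xi, L xi & (C0dist T (fun t => X t w) xi < del)%R].
Proof.
move=> LC; have [f fd] := separable_enum sep_H.
(* Countably many cells of arbitrarily small diameter cover C([0,T];H), so that the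
   neighborhood is a countable union of measurable events. *)
pose cell (i : nat * nat * seq nat) : set (R -> H) := [set u | forall q : rat,
  ratr q \in `[0, T]%R ->
  `|u (ratr q) - f (nth 0%N i.2 (Num.truncn (ratr q * i.1.2.+1%:R : R)))| <= i.1.1.+1%:R^-1].
pose good i := forall v, C0 H T v -> cell i v ->
  exists2 xi, L xi & C0dist T v xi < del.
(* Whether a cell is good does not depend on [w], so [B i] is measurable whichever way this is
   decided. *)
pose B i : set Om := if `[< good i >] then [set w | cell i (fun t => X t w)] else set0.
have -> : [set w | exists2 xi, L xi & (C0dist T (fun t => X t w) xi < del)%R] =
    \bigcup_i B i.
  apply/seteqP; split => [w [xi Lxi uxi]|w [i _]]; last first.
    by rewrite /B; case: ifPn => // /asboolP gi wi; exact: gi.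
  set u := fun t => X t w; have uc : C0 H T u by exact: cX.
  (* Half of the slack, since two paths of one cell differ by up to [2 * k.+1%:R^-1]. *)
  have del0 : 0 < (del - C0dist T u xi) / 2 by rewrite divr_gt0 // subr_gt0.
  have [k ke] := invS_lt del0.
  have k0 : 0 < (k.+1%:R^-1 : R) / 2 by rewrite divr_gt0 // invr_gt0.
  have [n un] := C0_uniform_continuity uc k0.
  pose grid (i : nat) : R := i%:R / n.+1%:R.
  have /choice[l lP] : forall i, exists j, `|u (grid i) - f j| < k.+1%:R^-1 / 2.
    by move=> i; exact: fd.
  (* The index records the precision, the mesh, and for each grid point up to [T] a dense point near
     the value of [u]; the successor makes room for the grid index of [T] itself. *)
  exists (k, n, mkseq l (Num.truncn (T * n.+1%:R)).+1) => //.
  have ucell : cell (k, n, mkseq l (Num.truncn (T * n.+1%:R)).+1) u.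
    move=> q /=; set t := ratr q; rewrite in_itv/= => /andP[t0 tT].
    have tn0 : 0 <= t * n.+1%:R by rewrite mulr_ge0.
    have /andP[h1 h2] := truncn_itv tn0.
    rewrite nth_mkseq; last first.
      by rewrite ltnS; apply: le_truncn; rewrite ler_pM2r.
    set i := Num.truncn _ in h1 h2 *.
    have g1 : grid i <= t by rewrite /grid ler_pdivrMr.
    have g2 : t - grid i <= n.+1%:R^-1.
      rewrite /grid lerBlDr -[X in _ <= X + _]mul1r -mulrDl ler_pdivlMr //.
      by rewrite (le_trans (ltW h2)) // -natr1 addrC.
    have g0 : 0 <= grid i by rewrite divr_ge0.
    have := un t (grid i); rewrite !in_itv/= t0 tT g0 (le_trans g1) // => /(_ isT isT).
    rewrite ger0_norm ?subr_ge0 // => /(_ g2) ui.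
    rewrite -(subrKA (u (grid i))) (le_trans (ler_normD _ _)) // [leRHS]splitr.
    by rewrite lerD // ltW.
  rewrite /B asboolT // => v vc vcell; exists xi => //.
  have uv t : t \in `[0, T]%R -> `|v t - u t| <= 2 * k.+1%:R^-1.
    apply: rat_agree => // q qT; have := ucell q qT; have := vcell q qT.
    set c := f _ => h1 h2; rewrite -(subrKA c).
    rewrite (le_trans (ler_normD _ _)) // mulr_natl mulr2n lerD //.
    by rewrite distrC.
  apply: (@le_lt_trans _ _ (2 * k.+1%:R^-1 + C0dist T u xi)).
    apply: C0dist_le => [|t tT]; first exact: ltW.
    rewrite -(subrKA (u t)) (le_trans (ler_normD _ _)) // lerD //; first exact: uv.
    by apply: le_C0dist => //; exact: LC.
  by move: ke; move: (k.+1%:R^-1 : R) (C0dist T u xi) => a b; lra.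
apply: countable_bigcupT_measurable => [|i]; first exact: countableP.
rewrite /B; case: ifPn => _ //.
(* A cell constrains only rational times, so its event is the complement of a countable union. *)
have -> : [set w | cell i (fun t => X t w)] = ~` (\bigcup_(q : rat)
  (if ratr q \in `[0, T]%R then ~` [set w | `|X (ratr q) w - f (nth 0%N i.2
     (Num.truncn (ratr q * i.1.2.+1%:R : R)))| <= i.1.1.+1%:R^-1] else set0)).
  rewrite setC_bigcup; apply/seteqP; split => [w wi q _|w wi q qT].
    by case: ifPn => [qT|_]; rewrite ?setC0 // setCK; exact: wi.
  by have := wi q I; rewrite qT setCK.
apply: measurableC; apply: bigcupT_measurable_rat => q.
case: ifPn => // /itvP qT; apply: measurableC.
by apply: measurable_ball_preimage; apply: mX; rewrite qT.
Qed.

End PathMeasurability.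

(** * Mass estimates from stationarity *)

Section Stationary.
Context {R : realType} {H : completeNormedModType R}.
Context {dS : measure_display} {S : measurableType dS}.
Context {dO : measure_display} {Om : measurableType dO} (P : probability Om R).
Variables (ip : H -> H -> R) (W : R -> H -> Om -> R) (eqn : equation H S).
Local Notation beta := (flow eqn).
Variables (PhiE : R -> R -> S -> H -> Om -> H).
Hypothesis PhiE_flow : stochastic_flow P ip W eqn PhiE.
Variable (eps : R).
Hypothesis eps01 : 0 < eps <= 1.

Lemma measurable_PhiE t s : 0 <= t -> measurable_fun setT
  (fun p : borel H * Om => (PhiE eps t s p.1 p.2 : borel H)).
Proof. by move=> t0; have [h _ _] := PhiE_flow eps01 s; exact: h. Qed.

Lemma measurable_PhiE_w t s (u : H) : 0 <= t ->
  measurable_fun setT (PhiE eps t s u : Om -> borel H).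
Proof.
move=> t0; have := measurable_PhiE s t0.
by move=> /measurableT_comp /(_ (measurable_pair1 (u : borel H))).
Qed.

Lemma C0_PhiE T s (u : H) w : C0 H T (fun t => PhiE eps t s u w).
Proof.
have [_ h _] := PhiE_flow eps01 s.
by apply: continuous_subspaceW (h u w) => t /= /itvP h'; rewrite h'.
Qed.

Definition hitting t s (B : set H) (u : H) : \bar R := P [set w | B (PhiE eps t s u w)].

Lemma measurable_hitting_event t s (B : set (borel H)) (u : H) : 0 <= t ->
  measurable B -> measurable [set w | B (PhiE eps t s u w)].
Proof.
by move=> t0 mB; rewrite -[X in measurable X]setTI; exact: measurable_PhiE_w.
Qed.

(** By joint measurability of [PhiE] the event is a measurable subset of the product, and the masses
    of its sections are measurable. *)
Lemma measurable_hitting t s (B : set (borel H)) : 0 <= t -> measurable B ->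
  measurable_fun setT (hitting t s B : borel H -> \bar R).
Proof.
move=> t0 mB; pose E := [set p : borel H * Om | B (PhiE eps t s p.1 p.2)].
have mE : measurable E.
  by rewrite -[X in measurable X]setTI; exact: measurable_PhiE.
have := measurable_fun_xsection P mE.
apply: eq_measurable_fun => u _ /=; congr (P _).
by apply/seteqP; split => w; rewrite /xsection /= inE.
Qed.

Lemma transitionE t s (B : set (borel H)) (u : H) : 0 <= t -> measurable B ->
  ((transition P PhiE eps t s \1_B u)%:E = hitting t s B u)%E.
Proof.
move=> t0 mB; rewrite /transition /Rintegral.
have mEv := measurable_hitting_event s u t0 mB.
under eq_integral => w _.
  have -> : (\1_B (PhiE eps t s u w))%:E = (\1_[set w | B (PhiE eps t s u w)] w)%:E :> \bar R.
    by rewrite !indicE; congr ((nat_of_bool _)%:R)%:E; apply/idP/idP; rewrite !inE.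
  over.
by rewrite integral_indic // setIT fineK // fin_num_measure.
Qed.

Lemma stationary_mass (mu : S -> probability (borel H) R) t s (B : set (borel H)) :
  stationary P eqn PhiE eps mu -> 0 <= t -> measurable B ->
  (\int[mu s]_u hitting t s B u = mu (beta t s) B)%E.
Proof.
move=> [_ st] t0 mB; rewrite -(st s t B t0 mB).
by apply: eq_integral => u _; rewrite transitionE.
Qed.

(** The pointwise bound is integrated against [mu s]. Starting points outside the ball contribute at
    most their mass, and stationarity turns each integrated exit probability into a mass at the
    later symbol. *)
Lemma stationary_mass_le (mu : S -> probability (borel H) R) t s (F : set (borel H))
    (r c : R) (N : nat) (tau : nat -> R) :
  stationary P eqn PhiE eps mu -> 0 <= t -> measurable F ->
  (forall j, 0 <= tau j) -> 0 <= c ->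
  (forall u, closedball r u -> hitting t s F u <=
     \sum_(j < N) hitting (tau j) s (~` closedball r) u + c%:E)%E ->
  (mu (beta t s) F <= mu s (~` closedball r) +
     \sum_(j < N) mu (beta (tau j) s) (~` closedball r) + c%:E)%E.
Proof.
move=> st t0 mF tau0 c0 h.
have mB := measurable_closedball (H := H) r.
have mBc : measurable (~` closedball r : set (borel H)) by exact: measurableC.
have mh j : measurable_fun setT (hitting (tau j) s (~` closedball r) : borel H -> \bar R).
  exact: measurable_hitting.
have hge0 t' B u : (0 <= hitting t' s B u)%E by exact: measure_ge0.
rewrite -(stationary_mass s st t0 mF).
pose g1 (u : borel H) : \bar R := (\1_(~` closedball r : set (borel H)) u)%:E.
pose g2 (u : borel H) : \bar R := (\sum_(j < N) hitting (tau j) s (~` closedball r) u)%E.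
have g20 u : (0 <= g2 u)%E by apply: sume_ge0 => j _; exact: hge0.
have mg1 : measurable_fun setT g1.
  by apply/measurable_EFinP; exact: measurable_indic.
have mg2 : measurable_fun setT g2 by apply: emeasurable_sum => j; exact: mh.
(* Outside the ball the indicator [g1] already dominates the hitting probability, so this majorant
   is valid everywhere. *)
apply: (@le_trans _ _ (\int[mu s]_u (g1 u + g2 u + c%:E))%E).
  apply: ge0_le_integral => //=.
  - exact: measurable_hitting.
  - by apply: emeasurable_funD => //; exact: emeasurable_funD.
  - move=> u _; rewrite /g1 indicE.
    have [ur|ur] := pselect (closedball r u).
      rewrite memNset; last by apply.
      by rewrite add0e; exact: h.
    rewrite mem_set // -addeA -[leLHS]adde0; apply: leeD.
      exact: probability_le1 (measurable_hitting_event _ _ t0 mF).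
    by rewrite adde_ge0 // lee_fin.
have g10 u : (0 <= g1 u)%E by rewrite lee_fin.
have -> : (\int[mu s]_u (g1 u + g2 u + c%:E) =
    \int[mu s]_u g1 u + \int[mu s]_u g2 u + c%:E)%E.
  have c_int : (\int[mu s]_u (cst c%:E) u = c%:E)%E.
    rewrite integral_cst // -[RHS]mule1; congr (_ * _)%E; exact: (probability_setT (mu s)).
  rewrite ge0_integralD //; last 2 first.
  - by move=> u _; rewrite adde_ge0.
  - exact: emeasurable_funD.
  by rewrite ge0_integralD // c_int.
apply: leeD => //; apply: leeD; first by rewrite /g1 integral_indic // setIT.
rewrite ge0_integral_sum //.
by apply: lee_sum => j _; rewrite stationary_mass.
Qed.

Lemma stationary_mass_ge (mu : S -> probability (borel H) R) t s (G : set (borel H))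
    (r c : R) :
  stationary P eqn PhiE eps mu -> 0 <= t -> measurable G -> 0 <= c ->
  (forall u, closedball r u -> c%:E <= hitting t s G u)%E ->
  (c%:E * mu s (closedball r) <= mu (beta t s) G)%E.
Proof.
move=> st t0 mG c0 h.
have mB := measurable_closedball (H := H) r.
rewrite -(stationary_mass s st t0 mG).
pose g1 (u : borel H) : \bar R := (\1_(closedball r : set (borel H)) u)%:E.
have mg1 : measurable_fun setT g1.
  by apply/measurable_EFinP; exact: measurable_indic.
have -> : (c%:E * mu s (closedball r) = \int[mu s]_u (c%:E * g1 u))%E.
  have -> : (mu s (closedball r) = \int[mu s]_u g1 u)%E.
    by rewrite /g1 integral_indic // setIT.
  by rewrite ge0_integralZl_EFin // => u _; rewrite lee_fin.
have g10 u : (0 <= g1 u)%E by rewrite lee_fin.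
apply: ge0_le_integral => //=.
- by move=> u _; apply: mule_ge0 => //; rewrite lee_fin.
- exact: emeasurable_funM.
- exact: measurable_hitting.
- move=> u _; rewrite /g1 indicE.
  have [ur|ur] := pselect (closedball r u).
    by rewrite mem_set // mule1; exact: h.
  by rewrite memNset // mule0; exact: measure_ge0.
Qed.

End Stationary.

(** * Frequent visits to large sets *)

Section LargeSets.
Context {R : realType} {dS : measure_display} {S : measurableType dS}.
Variable (m : probability S R).
Local Open Scope ereal_scope.

(** The upper limit of the complements is null, so the masses of their tail unions tend to zero. *)
Lemma eventually_large (E : nat -> set S) (theta : R) :
  (forall k, measurable (E k)) ->
  {ae m, forall s, exists K, forall k, (K <= k)%N -> E k s} -> (0 < theta)%R ->
  exists k, m (~` E k) <= theta%:E.
Proof.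
move=> mE aeE th0.
have mEc k : measurable (~` E k) by exact: measurableC.
have lim0 : m (lim_sup_set (fun k => ~` E k)) = 0.
  apply/(measure_negligible (mu := m)).
    by apply: bigcap_measurable => // *; apply: bigcup_measurable => // *; exact: mEc.
  apply: negligibleS aeE => s ls /= [K EK].
  by have [k /= Kk] := ls K I; apply; exact: EK.
have mU n : measurable (\bigcup_(k in [set k | (n <= k)%N]) ~` E k).
  by apply: bigcup_measurable => k _; exact: mEc.
have cv : m (\bigcup_(k in [set k | (n <= k)%N]) ~` E k) @[n --> \oo] --> 0.
  rewrite -lim0; apply: lim_sup_set_cvg => //.
  exact: le_lt_trans (probability_le1 _ (mU _)) (ltry _).
apply: contrapT => /forallNP h.
have : theta%:E <= 0.
  rewrite -(cvg_lim _ cv) //; apply: lime_ge; first by apply/cvg_ex; exists 0.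
  apply: nearW => n.
  have := h n => /negP; rewrite -ltNge => /ltW /le_trans; apply.
  apply: le_measure; rewrite ?inE; [exact: mEc|exact: mU|].
  by move=> s Es; exists n => /=.
by rewrite lee_fin leNgt th0.
Qed.

(** A reverse Fatou bound: the complement of the upper limit is an increasing union of sets, the
    [N]-th of which lies in the complement of [B N]. *)
Lemma frequently_large (B : nat -> set S) (theta : R) :
  (forall n, measurable (B n)) -> (forall n, m (~` B n) <= theta%:E) ->
  m (~` lim_sup_set B) <= theta%:E.
Proof.
move=> mB Bth.
pose F N := ~` \bigcup_(n in [set k | (N <= k)%N]) B n.
have mF N : measurable (F N).
  by apply: measurableC; apply: bigcup_measurable => k _; exact: mB.
have E : ~` lim_sup_set B = \bigcup_N F N.
  by rewrite /lim_sup_set setC_bigcap.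
rewrite E.
have mono : {homo F : n p / (n <= p)%N >-> (n <= p)%O}.
  move=> n p np; apply/subsetPset; apply: subsetC => s [k /= pk Bk].
  by exists k => //=; exact: leq_trans pk.
have := nondecreasing_cvg_mu (mu := m) mF (bigcupT_measurable _ mF) mono.
move=> /cvg_lim <- //.
apply: lime_le.
  apply: ereal_nondecreasing_is_cvgn => n p np; apply: le_measure; rewrite ?inE //.
  by apply/subsetPset; exact: mono.
apply: nearW => N; apply: le_trans (Bth N).
apply: le_measure; rewrite ?inE //; first exact: measurableC.
by apply: subsetC => s Bs; exists N => /=.
Qed.

(** The sets [D] stand in for the arbitrary predicate [X]; the complements for [theta = 1 / k.+1]
    have a null intersection. *)
Lemma ae_of_large (X : S -> Prop) :
  (forall theta : R, (0 < theta)%R -> exists D : set S,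
    [/\ measurable D, m (~` D) <= theta%:E & {ae m, forall s, D s -> X s}]) ->
  {ae m, forall s, X s}.
Proof.
move=> h.
have /choice[D hD] : forall k : nat, exists D : set S,
    [/\ measurable D, m (~` D) <= k.+1%:R^-1%:E & {ae m, forall s, D s -> X s}].
  by move=> k; apply: h; rewrite invr_gt0.
have aeX : {ae m, forall s, forall k, D k s -> X s}.
  by apply: ae_foralln => k; have [] := hD k.
have null : m.-negligible (\bigcap_k ~` D k).
  have mI : measurable (\bigcap_k ~` D k).
    by apply: bigcapT_measurable => k; apply: measurableC; have [] := hD k.
  apply/(negligibleP m mI).
  apply/eqP; rewrite eq_le measure_ge0 andbT.
  apply/lee_addgt0Pr => e e0; rewrite add0e.
  have [k ke] := invS_lt e0.
  have [mD Dk _] := hD k.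
  apply: le_trans (le_trans Dk _); last by rewrite lee_fin ltW.
  by apply: le_measure; rewrite ?inE //; [exact: measurableC|exact: bigcap_inf].
have := negligibleU null aeX; apply: negligibleS => s /= nX.
have [/existsNP[k]|] := pselect (~ forall k, (~` D k) s).
  by move=> /contrapT Dk; right => /(_ k Dk).
by move=> /contrapT all; left => k _; exact: all.
Qed.

End LargeSets.

(** * Measurable detection of pullback attraction *)

Section Attraction.
Context {R : realType} {H : completeNormedModType R}.
Context {dS : measure_display} {S : measurableType dS}.
Variables (beta : R -> S -> S) (Phi : R -> S -> H -> H) (A : S -> set H).
Hypothesis sep_H : separable H.
Hypothesis beta_meas : forall t, measurable_fun setT (beta t).
Hypothesis Phi_meas : forall t u0, 0 <= t ->
  measurable_fun setT (fun s => (Phi t s u0 : borel H)).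
Hypothesis Phi_cont : forall t s, 0 <= t -> continuous (Phi t s).

Definition attracts (s : S) := forall r e : R, 0 < e -> exists N : nat, forall t : R,
  N%:R <= t -> forall u, closedball r u ->
    neighborhood e (A s) (Phi t (beta (- t) s) u).

(* The attractor is not assumed to depend measurably on the symbol; [settled]
   is a measurable condition, stated without it, which forces the pullback images
   at time [n] to be close to the attractor. *)
Definition settled (f : nat -> H) (r e : R) (n : nat) : set S := [set s | forall i N,
  `|f i| <= r -> exists k j, [/\ (N <= k)%N, `|f j| <= r &
    `|Phi n%:R (beta (- n%:R) s) (f i) - Phi k%:R (beta (- k%:R) s) (f j)| < e]].

Lemma measurable_settled f r e n : measurable (settled f r e n).
Proof.
have -> : settled f r e n = \bigcap_i \bigcap_N (if `|f i| <= r then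
    \bigcup_k \bigcup_j (if (N <= k)%N && (`|f j| <= r) then
      [set s | `|Phi n%:R (beta (- n%:R) s) (f i) - Phi k%:R (beta (- k%:R) s) (f j)| < e]
      else set0) else setT).
  apply/seteqP; split => [s h i _ N _|s h i N fi].
    case: ifPn => // fi; have [k [j [Nk fj kj]]] := h i N fi.
    by exists k => //; exists j => //; rewrite Nk fj.
  have := h i I N I; rewrite fi => -[k _ [j _]].
  by case: ifPn => // /andP[Nk fj] kj; exists k, j.
have mP k u : measurable_fun setT (fun s => Phi k%:R (beta (- k%:R) s) u : borel H).
  exact: (measurableT_comp (Phi_meas u (ler0n _ _)) (beta_meas _)).
apply: bigcapT_measurable => i; apply: bigcapT_measurable => N; case: ifPn => // _.
apply: bigcupT_measurable => k; apply: bigcupT_measurable => j; case: ifPn => // _.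
exact: measurable_dist_lt.
Qed.

(** A late enough image lies within [e / 2] of the attractor, the settled condition adds [e], and
    continuity adds [e / 2] in passing from the dense sequence to [u]. The extra unit of radius
    leaves room for that approximation. *)
Lemma settled_attraction f r e n s : (forall x d, 0 < d -> exists i, `|x - f i| < d) ->
  attracts s -> 0 < e -> settled f (r + 1) e n s ->
  forall u, closedball r u ->
    neighborhood (e + e) (A s) (Phi n%:R (beta (- n%:R) s) u).
Proof.
move=> fd att e0 st u ur.
have e20 : 0 < e / 2 by rewrite divr_gt0.
have /cvgrPdist_lt/(_ _ e20)/nbhs_ballP[d /= d0 dP] :=
  @Phi_cont n%:R (beta (- n%:R) s) (ler0n _ _) u.
have d'0 : 0 < Num.min d 1 by rewrite lt_min d0 ltr01.
have [i] := fd u _ d'0; rewrite lt_min => /andP[uid ui1].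
have fi : `|f i| <= r + 1.
  rewrite -[f i](subrK u) addrC (le_trans (ler_normD _ _)) // lerD //.
  by rewrite distrC ltW.
have [N NP] := att (r + 1) _ e20.
have [k [j [Nk fj kj]]] := st i N fi.
have near_k := NP k%:R (_ : N%:R <= k%:R) (f j) fj.
have := neighborhood_triangle (neighborhood_triangle (near_k _) kj) (dP (f i) _).
rewrite ler_nat -ball_normE => /(_ Nk uid); apply: neighborhoodW.
lra.
Qed.

(** Late images lie within [e / 2] of a finite net of the compact attractor. Past some time the net
    points visited only finitely often are avoided, so the net point met at time [n] is met again
    arbitrarily late, by an image within [e] of the one at [n]. *)
Lemma settled_eventually f r e s : compact (A s) -> attracts s -> 0 < e ->
  exists K, forall n, (K <= n)%N -> settled f r e n s.
Proof.
move=> cA att e0.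
have e40 : 0 < e / 4 by rewrite divr_gt0.
pose visited (p : H) := forall N, exists k j, [/\ (N <= k)%N, `|f j| <= r &
  `|p - Phi k%:R (beta (- k%:R) s) (f j)| < e / 2].
have [D [DA Dcov]] : exists D : seq H, (forall x, x \in D -> A s x) /\
    forall a, A s a -> exists2 p, p \in D & `|p - a| < e / 4.
  have := cA; rewrite compact_cover => /(_ H (A s) (fun p => ball p (e / 4))).
  case=> [p _|a Aa|D DA cov]; first exact: ball_open.
    by exists a => //; exact: ballxx.
  exists (finmap.enum_fset D); split=> [x /DA|a /cov[p pD]]; first by rewrite inE.
  by rewrite -ball_normE /= => pa; exists p.
have [K KP] : exists K, forall p, p \in D -> ~ visited p -> forall k j, (K <= k)%N ->
    `|f j| <= r -> e / 2 <= `|p - Phi k%:R (beta (- k%:R) s) (f j)|.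
  have : forall p, exists K, ~ visited p -> forall k j, (K <= k)%N ->
    `|f j| <= r -> e / 2 <= `|p - Phi k%:R (beta (- k%:R) s) (f j)|.
    move=> p; have [vp|/existsNP[N nN]] := pselect (visited p); first by exists 0%N.
    exists N => _ k j Nk fj; rewrite leNgt; apply/negP => pk; apply: nN.
    by exists k, j.
  move=> /choice[K KP]; exists (\max_(p <- D) K p)%N => p pD vp k j Kk.
  by apply: KP => //; apply: leq_trans Kk; apply: leq_bigmax_seq.
have [N NP] := att r _ e40.
exists (maxn K N) => n; rewrite geq_max => /andP[Kn Nn] i L fi.
have Nn' : (N%:R : R) <= n%:R by rewrite ler_nat.
have [a Aa na] := (neighborhoodP _ _ _).1 (NP _ Nn' (f i) fi).
have [p pD pa] := Dcov a Aa.
have pn : `|p - Phi n%:R (beta (- n%:R) s) (f i)| < e / 2.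
  rewrite -(subrKA a) (le_lt_trans (ler_normD _ _)) // [`|a - _|]distrC.
  move: pa na; move: `|p - a| `|_ - a| => /= x y; lra.
have vp : visited p.
  by apply: contrapT => /(KP p pD) /(_ n i Kn fi); rewrite leNgt pn.
have [k [j [Lk fj pk]]] := vp L; exists k, j; split=> //.
rewrite -(subrKA p) (le_lt_trans (ler_normD _ _)) // distrC [ltRHS]splitr.
by rewrite ltrD.
Qed.

End Attraction.

(** * Logarithmic asymptotics *)

Section LimitsAtZero.
Context {R : realType}.
Implicit Types (f : R -> \bar R) (x : \bar R).

Lemma near0_right (V : set R) : (0 : R)^'+ V <->
  exists2 e : R, 0 < e & forall t, 0 < t < e -> V t.
Proof.
split=> [|[e e0 eV]].
  move=> /nbhs_ballP[e /= e0 eV]; exists e => // t /andP[t0 te].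
  by apply: eV => //; rewrite -ball_normE /= sub0r normrN gtr0_norm.
apply/nbhs_ballP; exists e => //= t; rewrite -ball_normE /= sub0r normrN => te t0.
by apply: eV; rewrite t0 -[t]gtr0_norm.
Qed.

Lemma limf_esup_le f x e : 0 < e ->
  (forall t, 0 < t < e -> (f t <= x)%E) -> (limf_esup f 0^'+ <= x)%E.
Proof.
move=> e0 h; apply: (@le_trans _ _ (ereal_sup [set f t | t in [set t | 0 < t < e]])).
  apply: ereal_inf_lbound; exists [set t | 0 < t < e] => //.
  by apply/near0_right; exists e.
by apply/ereal_supP => _ [t te <-]; exact: h.
Qed.

Lemma limf_esup_lt f x : (limf_esup f 0^'+ < x)%E ->
  exists2 e : R, 0 < e & forall t, 0 < t < e -> (f t < x)%E.
Proof.
move=> /ereal_inf_lt[_ [V /near0_right[e e0 eV] <-] Vx]; exists e => // t te.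
by apply: le_lt_trans Vx; apply: ereal_sup_ubound; exists t => //; exact: eV.
Qed.

Lemma limf_einf_ge f x e : 0 < e ->
  (forall t, 0 < t < e -> (x <= f t)%E) -> (x <= limf_einf f 0^'+)%E.
Proof.
move=> e0 h; rewrite /limf_einf leeNr; apply: (limf_esup_le e0) => t te.
by rewrite leeN2; exact: h.
Qed.

End LimitsAtZero.

Section LogMass.
Context {R : realType} {H : completeNormedModType R}.
Context {dS : measure_display} {S : measurableType dS}.
Variable mu : R -> S -> probability (borel H) R.
Implicit Types (B : set (borel H)).

Lemma log_mass_le s B eps (x : R) : measurable B -> 0 < eps ->
  (mu eps s B <= (expR (x / eps))%:E)%E -> (log_mass mu s B eps <= x%:E)%E.
Proof.
move=> mB e0; rewrite /log_mass -(fineK (fin_num_measure (mu eps s) _ mB)) lee_fin /lne.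
set p := fine _ => px; case: ifPn => [_|]; first by rewrite gt0_muleNy ?leNye.
rewrite -ltNge => p0; rewrite -EFinM lee_fin -ler_pdivlMl // mulrC.
by rewrite -ler_expR lnK.
Qed.

Lemma log_mass_ge s B eps (x : R) : measurable B -> 0 < eps ->
  ((expR (x / eps))%:E <= mu eps s B)%E -> (x%:E <= log_mass mu s B eps)%E.
Proof.
move=> mB e0; rewrite /log_mass -(fineK (fin_num_measure (mu eps s) _ mB)) lee_fin /lne.
set p := fine _ => px; have p0 : 0 < p by apply: lt_le_trans px; exact: expR_gt0.
rewrite [p <= 0]leNgt p0 /= -EFinM lee_fin -ler_pdivrMl // mulrC.
by rewrite -ler_expR lnK.
Qed.

Lemma le_log_mass s B eps (x : R) : measurable B -> 0 < eps ->
  (log_mass mu s B eps <= x%:E)%E -> (mu eps s B <= (expR (x / eps))%:E)%E.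
Proof.
move=> mB e0; rewrite /log_mass -(fineK (fin_num_measure (mu eps s) _ mB)) lee_fin /lne.
set p := fine _; case: ifPn => [p0 _|]; first by apply: le_trans p0 _; exact: expR_ge0.
rewrite -ltNge => p0; rewrite -EFinM lee_fin -ler_pdivlMl // mulrC => h.
by rewrite -[leLHS]lnK ?ler_expR.
Qed.

Lemma log_mass_le0 s B eps : measurable B -> 0 < eps -> (log_mass mu s B eps <= 0)%E.
Proof.
move=> mB e0; apply: log_mass_le => //; rewrite mul0r expR0.
exact: probability_le1.
Qed.

End LogMass.

Lemma ereal_between (R : realType) (x y : \bar R) : (x < y)%E -> exists r : R, (x < r%:E < y)%E.
Proof.
move: x y => [x| |] [y| |] //= xy.
- by rewrite lte_fin in xy; exists ((x + y) / 2); rewrite !lte_fin !midf_lt.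
- by exists (x + 1); rewrite lte_fin ltrDl ltr01 ltry.
- by exists (y - 1); rewrite ltNyr lte_fin ltrBlDr ltrDl ltr01.
- by exists 0; rewrite ltNyr ltry.
Qed.

(** Energy levels are taken from this countable family, so that the null sets attached to them can
    be united. *)
Lemma nat_frac_dense (R : realType) (x y : R) : 0 <= x -> x < y ->
  exists a b : nat, x < a%:R / b.+1%:R < y.
Proof.
move=> x0 xy; have yx : 0 < y - x by rewrite subr_gt0.
have [b bxy] := invS_lt yx.
have xb0 : 0 <= x * b.+1%:R by rewrite mulr_ge0.
exists (Num.truncn (x * b.+1%:R)).+1, b.
have /andP[h1' h2'] := truncn_itv xb0; apply/andP; split.
  by rewrite ltr_pdivlMr.
rewrite -natr1 mulrDl mul1r -(subrK x y) addrC.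
by rewrite ltr_leD // ler_pdivrMr.
Qed.

Lemma eventually_forall_lt (R : realType) (X : nat -> R -> Prop) (N : nat) :
  (forall j, exists2 e : R, 0 < e & forall t, 0 < t < e -> X j t) ->
  exists2 e : R, 0 < e & forall j, (j < N)%N -> forall t, 0 < t < e -> X j t.
Proof.
move=> h; elim: N => [|N [e e0 eX]]; first by exists 1.
have [e' e'0 e'X] := h N; exists (Num.min e e'); first by rewrite lt_min e0.
move=> j; rewrite ltnS leq_eqVlt => /predU1P[->|jN] t /andP[t0];
  rewrite lt_min => /andP[te te'].
- by apply: e'X; rewrite t0.
- by apply: eX => //; rewrite t0.
Qed.

(** The gap makes the segments [[- nu j - T, - nu j]] disjoint, as [energy_chain] requires. *)
Lemma sparse_subsequence (G : nat -> Prop) (T : nat) :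
  (forall N, exists2 n, (N <= n)%N & G n) ->
  exists nu : nat -> nat,
    [/\ (0 < nu 0)%N, forall j, (nu j + T < nu j.+1)%N & forall j, G (nu j)].
Proof.
move=> h; have /choice[g gP] : forall N, exists n, (N <= n)%N /\ G n.
  by move=> N; have [n] := h N; exists n.
exists (fun j => iter j (fun n => g (n + T).+1) (g 1%N)); split.
- exact: (gP 1%N).1.
- by move=> j; rewrite iterS; exact: (gP _).1.
- by case=> [|j]; [exact: (gP 1%N).2|rewrite iterS; exact: (gP _).2].
Qed.

(** The factor satisfies [n <= d / eps <= expR (d / eps)]: finitely many terms cost an arbitrarily
    small loss of rate. *)
Lemma exp_absorbs_factor (R : realType) (eps d a : R) (n : nat) :
  0 < eps -> 0 < d -> eps * n%:R <= d ->
  n%:R * expR (a / eps) <= expR ((a + d) / eps).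
Proof.
move=> e0 d0 ed; rewrite mulrDl expRD mulrC ler_pM2l ?expR_gt0 //.
apply: le_trans (expR_ge1Dx _).
by apply: (@le_trans _ _ (d / eps)); rewrite ?lerDr // ler_pdivlMr // mulrC.
Qed.

(** The radius is a sum of two equal parts, one for the tracking neighborhood and one for the
    distance between a solution and a low-action path. *)
Lemma closed_compact_separation (R : realType) (H : completeNormedModType R)
    (F K : set H) : closed F -> compact K -> F `&` K = set0 ->
  exists k : nat, forall x, F x -> ~ neighborhood (k.+1%:R^-1 + k.+1%:R^-1) K x.
Proof.
move=> cF cK FK.
pose P (n : nat) (p : H) := forall x, F x -> n.+1%:R^-1 + n.+1%:R^-1 <= `|x - p|.
have [|n _ /(_ n (leqnn n)) nP] := (compact_near_coveringP K).1 cK nat \oo P _.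
  move=> p Kp.
  have nFp : (~` F) p by move=> Fp; suff : (F `&` K) p by rewrite FK.
  have /nbhs_ballP[d /= d0 dF] : nbhs p (~` F).
    by apply: open_nbhs_nbhs; split => //; rewrite openC.
  have d40 : 0 < d / 4 by rewrite divr_gt0.
  have [N Nd] := invS_lt d40.
  exists (ball p (d / 2), [set n | (N <= n)%N]).
    by split; [apply: nbhsx_ballx; rewrite divr_gt0|exists N].
  move=> [q n] [/= pq Nn] x Fx; rewrite leNgt; apply/negP => xq.
  apply: (dF x) => //; move: pq; rewrite -!ball_normE /= => pq.
  have nN : (n.+1%:R^-1 : R) <= N.+1%:R^-1 by rewrite lef_pV2 ?posrE // ler_nat.
  rewrite -(subrKA q) (le_lt_trans (ler_normD _ _)) // [`|q - x|]distrC.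
  move: pq xq nN Nd; move: (N.+1%:R^-1 : R) (n.+1%:R^-1 : R) => a b.
  by move: `|p - q| `|x - q| => /= u v; lra.
exists n => x Fx /neighborhoodP[p Kp]; apply/negP; rewrite -leNgt.
exact: nP.
Qed.

Lemma pullback_attracts (R : realType) (H : completeNormedModType R)
    (dS : measure_display) (S : measurableType dS)
    (beta : R -> S -> S) (Phi : R -> S -> H -> H) (A : S -> set H) s :
  (forall B : set H, bounded_set B -> B !=set0 ->
     ereal_sup [set dist (Phi t (beta (- t) s) u) (A s) | u in B]
       @[t --> +oo] --> 0%E) -> attracts beta Phi A s.
Proof.
move=> h r e e0.
have [r0|r0] := leP 0 r; last first.
  by exists 0%N => t _ u; rewrite /closedball /= leNgt (lt_le_trans r0).
have bB : bounded_set (closedball r : set H).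
  by exists r; split; [exact: num_real|move=> M /ltW rM x xr; exact: le_trans rM].
have nB : (closedball r : set H) !=set0 by exists (0 : H); rewrite /closedball /= normr0.
have := h _ bB nB => /(_ [set x | (x < e%:E)%E]).
case=> [|M [_ MP]].
  by apply: open_nbhs_nbhs; split => /=; [exact: open_ereal_lt_ereal|rewrite lte_fin].
exists (Num.truncn M).+1 => t Mt u ur.
have Mt' : M < t by apply: lt_le_trans Mt; exact: truncnS_gt.
apply: le_lt_trans (MP t Mt'); apply: ereal_sup_ubound.
by exists u.
Qed.

(** * The large deviation bounds *)

Section GoodSegments.
Context {R : realType} {H : completeNormedModType R}.
Context {dS : measure_display} {S : measurableType dS} (m : probability S R).
Variables (ip : H -> H -> R) (eqn : equation H S).
Local Notation beta := (flow eqn).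
Variables (Phi : R -> S -> H -> H) (PhiC : (R -> H) -> R -> S -> H -> H).
Variables (A : S -> set H) (mu : R -> S -> probability (borel H) R).
Hypothesis sep_H : separable H.
Hypothesis beta_ergodic : ergodic_flow m beta.
Hypothesis Phi_flow : deterministic_flow ip eqn Phi.

Lemma beta0 s : beta 0 s = s.
Proof. by have [] := beta_ergodic. Qed.

Lemma betaD t1 t2 s : beta (t1 + t2) s = beta t1 (beta t2 s).
Proof. by have [] := beta_ergodic. Qed.

Lemma measurable_beta t : measurable_fun setT (beta t).
Proof.
have [_ _ mb _ _] := beta_ergodic.
by have /= := measurableT_comp mb (measurable_pair1 (t : R)).
Qed.

Lemma measurable_beta_preimage t D : measurable D -> measurable (beta t @^-1` D).
Proof. by move=> mD; rewrite -[X in measurable X]setTI; exact: measurable_beta. Qed.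

Lemma beta_mass t D : measurable D -> m (beta t @^-1` D) = m D.
Proof. by have [_ _ _ h _] := beta_ergodic; exact: h. Qed.

Lemma ae_beta t (X : S -> Prop) :
  {ae m, forall s, X s} -> {ae m, forall s, X (beta t s)}.
Proof.
move=> [N [mN N0 XN]]; exists (beta t @^-1` N); split.
- exact: measurable_beta_preimage.
- by rewrite beta_mass.
- by move=> s; exact: XN.
Qed.

Hypothesis h1 : pullback_attractor m eqn Phi A.
Hypothesis h5 : escaping_energy m eqn Phi PhiC.
Hypothesis h6 : weak_exponential_tightness m mu.

(** The rates at integer radii are replaced by measurable versions; by weak tightness their sublevel
    sets at [M] eventually contain almost every symbol. *)
Lemma tight_radius (M theta : R) : (0 < theta)%R -> exists (r : nat) (E : set S),
  [/\ measurable E, (m (~` E) <= theta%:E)%E &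
   {ae m, forall s, E s -> (tail_rate mu r%:R s < M%:E)%E}].
Proof.
move=> th0; have [mt tt] := h6.
have /choice[g gP] : forall k : nat, exists g : S -> \bar R,
    measurable_fun setT g /\ {ae m, forall s, tail_rate mu k%:R s = g s}.
  by move=> k; have [g mg ge] := mt k%:R; exists g.
pose E k := [set s | (g k s < M%:E)%E].
have mE k : measurable (E k).
  by have [mg _] := gP k; rewrite -[E k]setTI; exact: emeasurable_fun_infty_o.
have gae : {ae m, forall s, forall k, tail_rate mu k%:R s = g k s}.
  by apply: ae_foralln => k; have [] := gP k.
have [|k kE] := eventually_large (m := m) mE _ th0.
  apply: filterS2 gae tt => s gs /cvgeNyPlt/(_ M)[K [_ KP]].
  exists (Num.truncn K).+1 => k Kk; rewrite /E /= -gs; apply: KP.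
  by rewrite (lt_le_trans (truncnS_gt _)) // ler_nat.
exists k, (E k); split=> //; apply: filterS gae => s gs Es.
by rewrite gs.
Qed.

(** The last two clauses use [r + 1], since they are applied to a low-action path at distance at
    most one from a solution in the [r]-ball. *)
Definition good_segment (eta : S -> R) (M r c0 eta0 : R) (T n : nat) (s : S) :=
  [/\ (tail_rate mu r (beta (- (n + T)%:R) s) < M%:E)%E,
      eta0 <= eta (beta (- n%:R) s),
      forall u, closedball (r + 1) u -> neighborhood (eta0 / 2)
        (A (beta (- n%:R) s)) (Phi T%:R (beta (- T%:R) (beta (- n%:R) s)) u) &
      forall (u0 : H) phi, closedball (r + 1) u0 -> L2 T%:R phi ->
        ((`|PhiC (ext0 T%:R phi) T%:R (beta (- T%:R) (beta (- n%:R) s)) u0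
             - Phi T%:R (beta (- T%:R) (beta (- n%:R) s)) u0| ^+ 2)%:E <=
          c0%:E * cost T%:R phi)%E].

(** Each of the four conditions is arranged to fail with mass at most [theta / 4]. By invariance
    every segment is then good outside mass [theta], hence infinitely many are, and [theta] is
    arbitrary. *)
Lemma good_segments (eta : S -> R) (M : R) : measurable_fun setT eta ->
  (forall s, 0 < eta s) ->
  {ae m, forall s, exists (r c0 eta0 : R) (T : nat),
    [/\ (0 < T)%N, 1 <= c0, 0 < eta0 &
     forall N, exists2 n, (N <= n)%N & good_segment eta M r c0 eta0 T n s]}.
Proof.
move=> meta eta_gt0; apply: ae_of_large => theta th0.
have th40 : 0 < theta / 4 by rewrite divr_gt0.
have [r [E1 [mE1 E1th E1P]]] := tight_radius M th40.
pose E2 (k : nat) := [set s | k.+1%:R^-1 <= eta s].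
have mE2 k : measurable (E2 k).
  have -> : E2 k = setT `&` eta @^-1` `[k.+1%:R^-1, +oo[.
    by rewrite setTI; apply/seteqP; split => s; rewrite /E2 /= in_itv/= andbT.
  exact: meta.
have [|k2 E2th] := eventually_large (m := m) mE2 _ th40.
  apply: aeW => s; have [K Ks] := invS_lt (eta_gt0 s).
  exists K => k Kk; rewrite /E2 /= (le_trans _ (ltW Ks)) //.
  by rewrite lef_pV2 ?posrE // ler_nat.
pose eta0 : R := k2.+1%:R^-1.
have eta00 : 0 < eta0 by rewrite /eta0.
have eta40 : 0 < eta0 / 4 by rewrite divr_gt0.
have [f fd] := separable_enum sep_H.
have Phi_meas t u0 : 0 <= t -> measurable_fun setT (fun s => (Phi t s u0 : borel H)).
  by have [_ h] := Phi_flow; exact: h.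
(* [settled_attraction] loses one unit of radius and doubles the distance, which leaves [r + 1] and
   [eta0 / 2]. *)
pose E3 n := settled beta Phi f (r%:R + 1 + 1) (eta0 / 4) n.+1.
have mE3 n : measurable (E3 n) by apply: measurable_settled => // t; exact: measurable_beta.
have att : {ae m, forall s, attracts beta Phi A s}.
  by apply: filterS h1 => s [_ _]; exact: pullback_attracts.
have [|k3 E3th] := eventually_large (m := m) mE3 _ th40.
  apply: filterS2 h1 att => s [cA _ _] atts.
  have [K KP] := settled_eventually f (r%:R + 1 + 1) cA atts eta40.
  by exists K => k Kk; apply: KP; exact: leqW.
set T := k3.+1.
have T0 : 0 < (T%:R : R) by [].
have r10 : 0 < (r%:R + 1 : R) by rewrite ltr_wpDl.
(* The escape constant depends on the radius and on [T], so it is chosen after both. *)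
have [C [mC C1 Cesc]] := h5 r10 T0.
pose E4 (k : nat) := [set s | C s <= k.+1%:R].
have mE4 k : measurable (E4 k).
  have -> : E4 k = setT `&` C @^-1` `]-oo, k.+1%:R].
    by rewrite setTI; apply/seteqP; split => s; rewrite /E4 /= in_itv.
  exact: mC.
have [|k4 E4th] := eventually_large (m := m) mE4 _ th40.
  apply: aeW => s; exists (Num.truncn (C s)) => k Kk; rewrite /E4 /=.
  by rewrite (le_trans (ltW (truncnS_gt _))) // ler_nat.
(* The tail rate is read at the start of the segment, the other conditions at its end. *)
pose B n := beta (- (n + T)%:R) @^-1` E1 `&` beta (- n%:R) @^-1` (E2 k2 `&` E3 k3 `&` E4 k4).
have mE234 : measurable (E2 k2 `&` E3 k3 `&` E4 k4) by apply: measurableI => //; exact: measurableI.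
have mB n : measurable (B n) by apply: measurableI; exact: measurable_beta_preimage.
have Bth n : (m (~` B n) <= theta%:E)%E.
  rewrite /B setCI !preimage_setI !setCI.
  have mp t E : measurable E -> measurable (~` (beta t @^-1` E)).
    by move=> mE; apply: measurableC; exact: measurable_beta_preimage.
  have mass t E : measurable E -> (m (~` E) <= (theta / 4)%:E)%E ->
      (m (~` (beta t @^-1` E)) <= (theta / 4)%:E)%E.
    by move=> mE; rewrite preimage_setC beta_mass //; exact: measurableC.
  have -> : theta%:E = ((theta / 4)%:E + ((theta / 4)%:E + (theta / 4)%:E + (theta / 4)%:E))%E.
    by rewrite -!EFinD; congr EFin; lra.
  apply: le_trans (measureU2 _ _ _) _ => //; [exact: mp|by do 2?apply: measurableU; exact: mp|].
  apply: leeD; first exact: mass.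
  apply: le_trans (measureU2 _ _ _) _ => //; [by apply: measurableU; exact: mp|exact: mp|].
  apply: leeD; last exact: mass.
  apply: le_trans (measureU2 _ _ _) _ => //; [exact: mp|exact: mp|].
  by apply: leeD; exact: mass.
exists (lim_sup_set B); split.
- by apply: bigcapT_measurable => n; apply: bigcup_measurable => k _; exact: mB.
- exact: frequently_large.
have ae1 : {ae m, forall s, forall n : nat, E1 (beta (- (n + T)%:R) s) ->
    (tail_rate mu r%:R (beta (- (n + T)%:R) s) < M%:E)%E}.
  by apply: ae_foralln => n; exact: (ae_beta (- (n + T)%:R) E1P).
have ae2 : {ae m, forall s, forall n : nat, attracts beta Phi A (beta (- n%:R) s)}.
  by apply: ae_foralln => n; exact: (ae_beta (- n%:R) att).
have ae3 := ae_foralln (fun n : nat => ae_beta (- n%:R) Cesc).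
apply: filterS3 ae1 ae2 ae3 => s s1 s2 s3 sB.
exists r%:R, k4.+1%:R, eta0, T; split=> //; first by rewrite ler1n.
move=> N; have [n /= Nn [B1 [[B2 B3] B4]]] := sB N I; exists n => //; split.
- exact: s1.
- exact: B2.
- move=> u ur; have e : eta0 / 4 + eta0 / 4 = eta0 / 2 by lra.
  rewrite -e; apply: (settled_attraction _ fd (s2 n) eta40 B3) => //.
  by have [[_ _ c] _] := Phi_flow => t s' t0; exact: c.
- move=> u0 phi u0r phi2; apply: le_trans (s3 n u0 phi u0r phi2) _.
  by rewrite lee_wpmul2r ?lee_fin //; exact: cost_ge0.
Qed.

End GoodSegments.

(** * The upper bound at a fixed energy level *)

Section UpperRate.
Context {R : realType} {H : completeNormedModType R}.
Context {dS : measure_display} {S : measurableType dS} (m : probability S R).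
Context {dO : measure_display} {Om : measurableType dO} (P : probability Om R).
Variables (ip : H -> H -> R) (W : R -> H -> Om -> R) (eqn : equation H S).
Local Notation beta := (flow eqn).
Variables (Phi : R -> S -> H -> H) (PhiC : (R -> H) -> R -> S -> H -> H).
Variables (PhiE : R -> R -> S -> H -> Om -> H).
Variables (A : S -> set H) (mu : R -> S -> probability (borel H) R).
Hypothesis sep_H : separable H.
Hypothesis beta_ergodic : ergodic_flow m beta.
Hypothesis PhiC_flow : controlled_flow ip eqn PhiC.
Hypothesis PhiE_flow : stochastic_flow P ip W eqn PhiE.

Let betaE0 : forall s, beta 0 s = s := beta0 beta_ergodic.
Let betaED : forall t1 t2 s, beta (t1 + t2) s = beta t1 (beta t2 s) :=
  betaD beta_ergodic.

Hypothesis mu_stationary : forall eps, 0 < eps <= 1 -> stationary P eqn PhiE eps (mu eps).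
Hypothesis LDP : forall (T : R) (s : S), 0 < T -> uniform_LDP P PhiC PhiE s T.

(** Of the three losses of [del'], one comes from tracking below level [M], one from the LDP, and
    one from the number of terms in the union bound. *)
Lemma limsup_log_mass_le (eta : S -> R) (s : S) (M del del' r c0 eta0 : R) (T : nat)
    (F : set H) :
  0 < del <= 1 -> 0 < del' -> del' < M -> (0 < T)%N -> 1 <= c0 -> 0 < eta0 ->
  (forall N, exists2 n, (N <= n)%N & good_segment eqn Phi PhiC A mu eta (- M) r c0 eta0 T n s) ->
  (forall t, 0 < t -> forall u, C0 H t u ->
     neighborhood (eta (beta (- t) s)) (A (beta (- t) s)) (u 0) ->
     (action PhiC (beta (- t) s) t u <= (M - del')%:E)%E ->
     neighborhood del (sublevel eqn PhiC A s M) (u t)) ->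
  closed F -> (forall x, F x -> ~ neighborhood (del + del) (sublevel eqn PhiC A s M) x) ->
  (limf_esup (log_mass mu s F) 0^'+ <= (- (M - 3 * del'))%:E)%E.
Proof.
move=> /andP[del0 del1] del'0 del'M T0 c01 eta00 /(sparse_subsequence T)[nu [nu0 nuS nuG]]
  track cF FK.
have mF := closed_borel cF.
have mB := measurable_closedball (H := H) r.
have mBc : measurable (~` closedball r : set (borel H)) by exact: measurableC.
(* Enough segments for [N.+1] failures to cost at least [M]. *)
pose N := Num.truncn (M * c0 / (eta0 / 2) ^+ 2).
have MN : M * c0 <= N.+1%:R * (eta0 / 2) ^+ 2.
  by rewrite -ler_pdivrMr ?exprn_gt0 ?divr_gt0 // ltW // truncnS_gt.
have T0R : 0 < (T%:R : R) by rewrite ltr0n.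
pose t1 : R := (nu N)%:R + T%:R.
have t10 : 0 < t1 by rewrite ltr_wpDl.
pose s0 := beta (- t1) s.
(* The [minn] makes [tau j] nonnegative for every [j]; only [j <= N] is meaningful. *)
pose tau j : R := t1 - (nu (minn j N))%:R - T%:R.
have numono j : (j <= N)%N -> (nu j <= nu N)%N.
  apply: (@homo_leq _ nu (fun k l => (k <= l)%N)) => // [k l n|k]; first exact: leq_trans.
  by apply: leq_trans (ltnW (nuS k)); exact: leq_addr.
have tau0 j : 0 <= tau j.
  by rewrite /tau /t1 addrAC addrK subr_ge0 ler_nat numono // geq_minr.
have tauE j : beta (tau j) s0 = beta (- (nu (minn j N) + T)%:R) s.
  by rewrite /s0 -betaED natrD; congr (beta _ s); rewrite /tau; ring.
have s0E : beta t1 s0 = s by rewrite /s0 -betaED subrr betaE0.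
have s0E' : s0 = beta (- (nu N + T)%:R) s by rewrite /s0 natrD.
have M'0 : 0 <= M - del' by rewrite subr_ge0 ltW.
have [e1 e10 e1P] := eventually_forall_lt N.+1 (fun j =>
  limf_esup_lt (let: And4 tj _ _ _ := nuG (minn j N) in tj)).
have r10 : 0 < Num.max r 1 by rewrite lt_max ltr01 orbT.
have [e2 /andP[e20 e21] e2P] := LDP s0 t10 r10 M'0 del'0 del0.
(* The final sum has [N.+3] terms: the initial mass, [N.+1] exits, and the LDP error. *)
pose e3 := del' / N.+3%:R.
have e30 : 0 < e3 by rewrite divr_gt0.
pose e := Num.min e1 (Num.min e2 e3).
have e0 : 0 < e by rewrite !lt_min e10 e20.
apply: (limf_esup_le e0) => eps /andP[eps0]; rewrite !lt_min => /and3P[ee1 ee2 ee3].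
have eps01 : 0 < eps <= 1 by rewrite eps0 (le_trans (ltW ee2)).
have epse2 : 0 < eps <= e2 by rewrite eps0 ltW.
have [_ ldpb] := e2P eps epse2.
have tail j : (mu eps (beta (tau j) s0) (~` closedball r) <= (expR (- M / eps))%:E)%E.
  apply: le_log_mass => //; rewrite tauE.
  have jN : (minn j N < N.+1)%N by rewrite ltnS geq_minr.
  have := e1P _ jN eps; rewrite (minn_idPl (geq_minr j N)).
  by move=> /(_ (introT andP (conj eps0 ee1))) /ltW.
apply: log_mass_le => //.
rewrite -[in leLHS]s0E.
have c0' : 0 <= expR (- (M - del' - del') / eps) by exact: expR_ge0.
apply: (le_trans (@stationary_mass_le _ _ _ _ _ _ _ _ _ _ _ PhiE_flow eps eps01
  (mu eps) t1 s0 F r _ N.+1 tau (mu_stationary eps01) (ltW t10) mF tau0 c0' _)).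
  move=> u0 u0r.
  pose bad := ~` [set w | exists2 xi, action_level PhiC s0 t1 u0 (M - del') xi &
     (C0dist t1 (fun t => PhiE eps t s0 u0 w) xi < del)%R].
  have mbad : measurable bad.
    apply: measurableC; apply: measurable_path_neighborhood => //.
    - by move=> t tt0; exact: (measurable_PhiE_w PhiE_flow).
    - by move=> w; exact: (C0_PhiE PhiE_flow).
    - by move=> xi [].
  have Pbad : (P bad <= (expR (- (M - del' - del') / eps))%:E)%E.
    by apply: ldpb; rewrite le_max; apply/orP; left.
  pose out j := [set w | (~` closedball r) (PhiE eps (tau j) s0 u0 w)].
  have mout j : measurable (out j) by exact: (measurable_hitting_event PhiE_flow).
  have mUout : measurable (\big[setU/set0]_(j < N.+1) out j).
    by apply: bigsetU_measurable => j _; exact: mout.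
  (* A solution ending in [F] either leaves the [r]-ball at a chosen time or strays from every path
     of action at most [M - del']. *)
  apply: (@le_trans _ _ (P (\big[setU/set0]_(j < N.+1) out j `|` bad))).
    apply: le_measure; rewrite ?inE //.
    - by apply: (measurable_hitting_event PhiE_flow) => //; exact: ltW.
    - exact: measurableU.
    move=> w /= Fw; apply: contrapT => /not_orP[nout /contrapT[xi [xic xi0 xiM] xid]].
    apply: (FK _ Fw).
    have wc : C0 H t1 (fun t => PhiE eps t s0 u0 w) by exact: (C0_PhiE PhiE_flow).
    have close t : 0 <= t <= t1 -> `|PhiE eps t s0 u0 w - xi t| < del.
      by move=> tt; apply: le_lt_trans xid; apply: (@le_C0dist _ _ _ (fun t => PhiE eps t s0 u0 w)).
    apply: (@neighborhood_triangle _ _ _ _ _ (xi t1)); last first.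
      by apply: close; rewrite lexx ltW.
    apply: (@low_action_endpoint _ _ _ _ ip eqn betaE0 betaED Phi PhiC PhiC_flow A eta s
      (r + 1) T%:R c0 eta0 M (M - del') del N (fun j => (nu j)%:R)) => //.
    - by rewrite ltrBlDr ltrDl.
    - by rewrite ltr0n.
    - by move=> j; rewrite -natrD ltr_nat.
    - by move=> j jN u1 phi u1r phi2; have [_ _ _ h] := nuG j; exact: h.
    - by move=> j jN u1 u1r; have [_ _ h _] := nuG j; exact: h.
    - by move=> j jN; have [_ h _ _] := nuG j.
    - move=> j jN.
      have tauj : t1 - (nu j)%:R - T%:R = tau j by rewrite /tau (minn_idPl jN).
      have inside : `|PhiE eps (tau j) s0 u0 w| <= r.
        apply: contrapT => nin; apply: nout.
        rewrite -bigcup_mkord; exists j => //=; exact: nin.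
      rewrite -/t1 tauj /closedball /=.
      have := close (tau j); rewrite tau0 => /(_ _)/wrap[].
        by rewrite /tau lerBlDr lerBlDr -addrA lerDl addr_ge0.
      move=> cl; rewrite -[xi _](subrK (PhiE eps (tau j) s0 u0 w)) addrC.
      rewrite (le_trans (ler_normD _ _)) // lerD // distrC (le_trans (ltW cl)) //.
  apply: le_trans (measureU2 _ _ _) _ => //.
  apply: leeD => //.
  exact: Boole_inequality.
have lead : (mu eps s0 (~` closedball r) <= (expR (- M / eps))%:E)%E.
  have := tail N; rewrite tauE minnn -s0E' //.
apply: (@le_trans _ _ ((expR (- M / eps))%:E +
  \sum_(j < N.+1) (expR (- M / eps))%:E + (expR (- (M - del' - del') / eps))%:E)%E).
  by apply: leeD => //; apply: leeD => //; apply: lee_sum => j _; exact: tail.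
rewrite sumEFin -!EFinD lee_fin sumr_const card_ord.
have expM : expR (- M / eps) <= expR (- (M - del' - del') / eps).
  by rewrite ler_expR ler_pM2r ?invr_gt0 //; lra.
apply: (@le_trans _ _ (N.+3%:R * expR (- (M - del' - del') / eps))).
  rewrite mulr_natl [leRHS]mulrS [X in _ <= _ + X]mulrS [leLHS]addrC lerD2l lerD //.
  by rewrite ler_wMn2r.
have -> : - (M - 3 * del') = - (M - del' - del') + del' by lra.
apply: exp_absorbs_factor => //.
by rewrite mulrC -ler_pdivlMl // mulrC ltW.
Qed.

End UpperRate.

(** * The bounds for closed and for open sets *)

Section LargeDeviations.
Context {R : realType} {H : completeNormedModType R}.
Context {dS : measure_display} {S : measurableType dS} (m : probability S R).
Context {dO : measure_display} {Om : measurableType dO} (P : probability Om R).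
Variables (ip : H -> H -> R) (W : R -> H -> Om -> R) (eqn : equation H S).
Local Notation beta := (flow eqn).
Variables (Phi : R -> S -> H -> H) (PhiC : (R -> H) -> R -> S -> H -> H).
Variables (PhiE : R -> R -> S -> H -> Om -> H).
Variables (A : S -> set H) (mu : R -> S -> probability (borel H) R).
Hypotheses (ip_H : inner_product ip) (sep_H : separable H).
Hypothesis beta_ergodic : ergodic_flow m beta.
Hypothesis Phi_flow : deterministic_flow ip eqn Phi.
Hypothesis PhiC_flow : controlled_flow ip eqn PhiC.
Hypothesis PhiE_flow : stochastic_flow P ip W eqn PhiE.

Let betaE0 : forall s, beta 0 s = s := beta0 beta_ergodic.
Let betaED : forall t1 t2 s, beta (t1 + t2) s = beta t1 (beta t2 s) :=
  betaD beta_ergodic.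

Hypothesis mu_stationary : forall eps, 0 < eps <= 1 -> stationary P eqn PhiE eps (mu eps).
Hypothesis LDP : forall (T : R) (s : S), 0 < T -> uniform_LDP P PhiC PhiE s T.
Hypothesis h1 : pullback_attractor m eqn Phi A.
Hypothesis h6 : weak_exponential_tightness m mu.

(** The exceptional null set of the tracking property depends on the level and the tolerances.
    Restricting these to countably many values lets one null set serve all closed [F]. *)
Lemma ldp_upper (h3 : compact_sublevels m eqn PhiC A) (h4 : tracking m eqn PhiC A)
    (h5 : escaping_energy m eqn Phi PhiC) :
  {ae m, forall s, forall F : set H, closed F ->
     (limf_esup (log_mass mu s F) 0^'+ <=
      - ereal_inf [set quasipotential eqn PhiC A s u | u in F])%E}.
Proof.
pose level (a b : nat) : R := a%:R / b.+1%:R.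
pose rate (a b k l : nat) s := 0 < level a b -> l.+1%:R^-1 < level a b ->
  forall F, closed F ->
  (forall x, F x -> ~ neighborhood (k.+1%:R^-1 + k.+1%:R^-1)
     (sublevel eqn PhiC A s (level a b)) x) ->
  (limf_esup (log_mass mu s F) 0^'+ <= (- (level a b - 3 * l.+1%:R^-1))%:E)%E.
have ae_rate : {ae m, forall s, forall a b k l, rate a b k l s}.
  apply: ae_foralln => a; apply: ae_foralln => b; apply: ae_foralln => k.
  apply: ae_foralln => l.
  have [L0|] := ltP 0 (level a b); last by move=> L0; apply: aeW => s; rewrite /rate ltNge L0.
  have k0 : 0 < (k.+1%:R^-1 : R) by rewrite invr_gt0.
  have l0 : 0 < (l.+1%:R^-1 : R) by rewrite invr_gt0.
  have [eta [meta eta01 track]] := h4 _ _ _ k0 l0 L0.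
  have eta0 s : 0 < eta s by have /andP[] := eta01 s.
  have := good_segments sep_H beta_ergodic Phi_flow h1 h5 h6 (- level a b) meta eta0.
  apply: filterS2 track => s tr [r [c0 [e0 [T [T0 c01 e00 seg]]]]] _ lM F cF FK.
  apply: (limsup_log_mass_le sep_H beta_ergodic PhiC_flow PhiE_flow
    mu_stationary LDP _ l0 lM T0 c01 e00 seg tr cF FK).
  by rewrite k0 invf_le1 // ler1n.
apply: filterS2 h3 ae_rate => s cK rates F cF.
rewrite leNgt; apply/negP => /ereal_between[z /andP[Iz zF]].
have mF := closed_borel cF.
have [z0|z0] := leP 0 z.
  move: zF; rewrite ltNge => /negP; apply; apply: (@le_trans _ _ 0%E); last by rewrite lee_fin.
  by apply: (limf_esup_le ltr01) => t /andP[t0 _]; exact: log_mass_le0.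
rewrite lteNl -EFinN in Iz.
have [y /andP[zy yI]] := ereal_between Iz.
rewrite lte_fin in zy.
have nz0 : 0 <= - z by rewrite oppr_ge0 ltW.
have [a [b /andP[zM My]]] := nat_frac_dense nz0 zy.
have M0 : 0 < level a b by apply: le_lt_trans zM.
(* The rate loses [3 * l.+1%:R^-1]; taking less than a third of the gap for the tolerance keeps the
   bound below [z]. *)
have gap : 0 < (level a b + z) / 3 by rewrite divr_gt0 // -[z]opprK subr_gt0.
have [l lgap] := invS_lt gap.
have FK0 : F `&` sublevel eqn PhiC A s (level a b) = set0.
  rewrite -subset0 => u [Fu]; rewrite /sublevel /= leNgt => /negP; apply.
  apply: (@lt_trans _ _ y%:E); first by rewrite lte_fin.
  by apply: lt_le_trans yI _; apply: ereal_inf_lbound; exists u.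
have [k kP] := closed_compact_separation cF (cK _ M0) FK0.
have lM : l.+1%:R^-1 < level a b.
  apply: lt_trans lgap _; rewrite ltr_pdivrMr //; move: M0 z0.
  by move: (level a b) => M; lra.
move: zF; rewrite ltNge => /negP; apply.
apply: le_trans (rates a b k l M0 lM F cF kP) _; rewrite lee_fin.
by move: lgap; move: (level a b) (l.+1%:R^-1 : R) => M d; lra.
Qed.

(** Shrinking the target ball raises the infimum, so the limit is a supremum and its strict upper
    bounds hold for every radius. *)
Lemma quasipotential_lt s ustar (y : R) (e : R) : 0 < e ->
  (quasipotential eqn PhiC A s ustar < y%:E)%E ->
  exists r u, [/\ 0 < r, C0 H r u, A (beta (- r) s) (u 0), ball ustar e (u r) &
    (action PhiC (beta (- r) s) r u < y%:E)%E].
Proof.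
move=> e0; rewrite /quasipotential; set f := fun eta : R => ereal_inf _.
have mono : {in `]0, e + 1[ &, {homo f : n m / n <= m >-> (m <= n)%E}}.
  move=> n p _ _ np; apply: le_ereal_inf => _ [r [u [r0 uc u0 ub ->]]].
  by exists r, u; split=> //; exact: le_ball ub.
have := @nonincreasing_at_right_cvge _ f 0 (BLeft (e + 1)) _ mono.
rewrite bnd_simp ltr_wpDr // => /(_ isT)/cvg_lim -> // fy.
have /ereal_inf_lt[_ [r [u [r0 uc u0 ub ->]]] uy] : (f e < y%:E)%E.
  apply: le_lt_trans fy; apply: ereal_sup_ubound; exists e => //=.
  by rewrite in_itv/= e0 ltrDl ltr01.
by exists r, u.
Qed.

(** One [d] pays for the LDP, the other for the factor one half lost by starting in the ball. *)
Lemma ldp_lower_at (s : S) (G : set H) (ustar : H) (y d : R) (r1 : R) (a : nat -> H) :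
  open G -> G ustar -> 0 < d ->
  (forall N, exists2 K, (N <= K)%N & (tail_rate mu r1 (beta (- K%:R) s) < (-1)%:E)%E) ->
  (forall n t, 0 <= t -> Phi t (beta (- n%:R) s) @` A (beta (- n%:R) s) =
     A (beta t (beta (- n%:R) s))) ->
  (forall n, A (beta (- n%:R) s) = [set a n]) ->
  (forall n, attracts beta Phi A (beta (- n%:R) s)) ->
  (quasipotential eqn PhiC A s ustar < y%:E)%E ->
  ((- (y + 2 * d))%:E <= limf_einf (log_mass mu s G) 0^'+)%E.
Proof.
move=> oG Gu d0 tails inv sing att Ey.
have mG := open_borel oG.
have mB := measurable_closedball (H := H) r1.
have /nbhs_ballP[e /= e0 eG] : nbhs ustar G by apply: open_nbhs_nbhs.
have e30 : 0 < e / 3 by rewrite divr_gt0.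
have [r [u [r0 uc u0 ub uy]]] := quasipotential_lt e30 Ey.
have [_ [phi steer <-] phiy] := ereal_inf_lt uy.
have [phi2 phiE] := steer.
have y0 : 0 < y by rewrite -lte_fin; apply: le_lt_trans phiy; exact: cost_ge0.
pose n := (Num.truncn r).+1.
have rn : r < n%:R by exact: truncnS_gt.
have nr0 : 0 <= n%:R - r by rewrite subr_ge0 ltW.
(* Free evolution from time [- n] to [- r], then the nearly optimal control up to time [0];
   invariance makes [h] send the attractor point at [- n] to [u r]. *)
pose h x := PhiC (ext0 r phi) r (beta (- r) s) (Phi (n%:R - r) (beta (- n%:R) s) x).
have hc : continuous h.
  move=> x; apply: continuous_comp; first exact: (Phi_continuous Phi_flow).
  by apply: (PhiC_continuous PhiC_flow); [exact: L2loc_ext0|exact: ltW].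
have betaC (p q : R) : beta p (beta q s) = beta (p + q) s by rewrite betaED.
have ha : h (a n) = u r.
  have : A (beta (- r) s) (u 0) by [].
  have -> : beta (- r) s = beta (n%:R - r) (beta (- n%:R) s).
    by rewrite betaC; congr (beta _ s); ring.
  rewrite -inv // sing => -[_ -> h0].
  by rewrite /h h0 (phiE r) // lexx ltW.
(* Continuity of [h] sets the accuracy [th] with which the free flow from [- K] must reach the
   attractor point at [- n]. *)
have /cvgrPdist_lt/(_ _ e30)/nbhs_ballP[th /= th0 thP] := hc (a n).
have [Na NaP] := att n r1 th th0.
have [K KN Kt] := tails (n + Na)%N.
have KnNa : (Na%:R : R) <= K%:R - n%:R.
  by rewrite lerBrDr -natrD ler_nat addnC.
have Kn0 : 0 <= K%:R - n%:R :> R by apply: le_trans KnNa.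
pose s0 := beta (- K%:R) s.
have Kr0 : 0 <= K%:R - r by move: Kn0 nr0; lra.
have K0 : 0 < K%:R :> R by move: Kr0 r0; lra.
have s0E : beta K%:R s0 = s by rewrite /s0 betaC subrr betaE0.
pose xi u1 t := PhiC (delayed (K%:R - r) r phi) t s0 u1.
have xiend u1 : closedball r1 u1 -> `|u r - xi u1 K%:R| < e / 3.
  move=> u1r.
  have -> : xi u1 K%:R = h (Phi (K%:R - n%:R) s0 u1).
    have rr : 0 <= r <= r by rewrite lexx ltW.
    have := PhiC_delayed ip_H betaED Phi_flow PhiC_flow s0 u1 Kr0 r0 phi2 rr.
    rewrite subrK /xi => ->.
    rewrite /h; congr (PhiC _ _ _ _).
      by rewrite /s0 betaC; congr (beta _ s); ring.
    have -> : beta (- n%:R) s = beta (K%:R - n%:R) s0.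
      by rewrite /s0 betaC; congr (beta _ s); ring.
    rewrite -(Phi_cocycle ip_H betaED Phi_flow PhiC_flow) //.
    by congr (Phi _ _ _); ring.
  rewrite -ha; apply: thP; rewrite -ball_normE /=.
  have s0n : s0 = beta (- (K%:R - n%:R)) (beta (- n%:R) s).
    by rewrite /s0 betaC; congr (beta _ s); ring.
  have := NaP _ KnNa u1 u1r; rewrite -s0n sing => /neighborhoodP[_ ->].
  by rewrite distrC.
have xiy u1 : (action PhiC s0 K%:R (xi u1) <= cost r phi)%E.
  have := action_delayed betaE0 betaED PhiC_flow s0 u1 Kr0 r0 phi2.
  by rewrite subrK.
have r10 : 0 < Num.max r1 1 by rewrite lt_max ltr01 orbT.
have [e2 /andP[e20 e21] e2P] := LDP s0 K0 r10 (ltW y0) d0 e30.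
have [e1 e10 e1P] := limf_esup_lt Kt.
pose e' := Num.min e1 (Num.min e2 (d / 2)).
have e'0 : 0 < e' by rewrite !lt_min e10 e20 divr_gt0.
apply: (limf_einf_ge e'0) => eps /andP[eps0].
rewrite !lt_min => /and3P[ee1 ee2 eed].
have eps01 : 0 < eps <= 1 by rewrite eps0 (le_trans (ltW ee2)).
have epse2 : 0 < eps <= e2 by rewrite eps0 ltW.
have [ldpa _] := e2P eps epse2.
(* A tail rate below [-1] leaves mass at most [expR (- 1 / eps)] outside the ball, which is at most
   one half for [eps <= 1]. *)
have half : ((2^-1)%:E <= mu eps s0 (closedball r1))%E.
  have mBc : measurable (~` closedball r1 : set (borel H)) by exact: measurableC.
  have Bc : (mu eps s0 (~` closedball r1) <= (2^-1)%:E)%E.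
    have small := e1P eps (introT andP (conj eps0 ee1)).
    apply: le_trans (le_log_mass mBc eps0 (ltW small)) _.
    rewrite lee_fin mulN1r expRN lef_pV2 ?posrE ?expR_gt0 //.
    apply: le_trans (expR_ge1Dx _); rewrite lerD2l invf_ge1 //.
    by case/andP: eps01.
  move: Bc; rewrite probability_setC // -(fineK (fin_num_measure (mu eps s0) _ mB)).
  by rewrite -EFinB !lee_fin; lra.
apply: log_mass_ge => //; rewrite -[in leRHS]s0E.
have hit u1 : closedball r1 u1 ->
    ((expR (- (y + d) / eps))%:E <= hitting P PhiE eps K%:R s0 G u1)%E.
  move=> u1r.
  have lev : action_level PhiC s0 K%:R u1 y (xi u1).
    split.
    - by apply: (PhiC_path PhiC_flow); exact: L2loc_delayed.
    - by rewrite /xi (PhiC_at0 PhiC_flow) //; exact: L2loc_delayed.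
    - exact: le_trans (xiy u1) (ltW phiy).
  have u1r' : `|u1| <= Num.max r1 1 by rewrite le_max; apply/orP; left.
  have afin : (action PhiC s0 K%:R (xi u1) \is a fin_num)%E.
    rewrite ge0_fin_numE; last exact: action_ge0.
    exact: lt_trans (le_lt_trans (xiy u1) phiy) (ltry _).
  apply: (@le_trans _ _ (expR (- (fine (action PhiC s0 K%:R (xi u1)) + d) / eps))%:E).
    rewrite lee_fin ler_expR ler_pM2r ?invr_gt0 // lerN2 lerD2r -lee_fin fineK //.
    exact: le_trans (xiy u1) (ltW phiy).
  apply: le_trans (ldpa u1 (xi u1) u1r' lev) _.
  have xic : C0 H K%:R (xi u1) by case: lev.
  have mnear : measurable [set w |
      (C0dist K%:R (fun t => PhiE eps t s0 u1 w) (xi u1) < e / 3)%R].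
    have -> : [set w | (C0dist K%:R (fun t => PhiE eps t s0 u1 w) (xi u1) < e / 3)%R] =
        [set w | exists2 xi0, [set xi u1] xi0 &
          (C0dist K%:R (fun t => PhiE eps t s0 u1 w) xi0 < e / 3)%R].
      by apply/seteqP; split => w /=; [exists (xi u1)|move=> [_ ->]].
    apply: measurable_path_neighborhood => //.
    - by move=> t t0; exact: (measurable_PhiE_w PhiE_flow).
    - by move=> w; exact: (C0_PhiE PhiE_flow).
    - by move=> _ ->.
  apply: le_measure; rewrite ?inE //.
    by apply: (measurable_hitting_event PhiE_flow) => //; exact: ltW.
  move=> w /= near_xi; apply: eG; rewrite -ball_normE /=.
  have wc : C0 H K%:R (fun t => PhiE eps t s0 u1 w) by exact: (C0_PhiE PhiE_flow).
  have KK : (K%:R : R) \in `[0, K%:R]%R by rewrite in_itv/= lexx ltW.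
  have d1 := le_lt_trans (le_C0dist wc xic KK) near_xi.
  have d2 := xiend u1 u1r.
  have d3 : `|ustar - u r| < e / 3 by move: ub; rewrite -ball_normE.
  (* Three errors of [e / 3]: the target ball of the quasipotential, the changed starting point, and
     the LDP neighborhood. *)
  rewrite -(subrKA (u r)) (le_lt_trans (ler_normD _ _)) //.
  apply: (@lt_le_trans _ _ (e / 3 + (e / 3 + e / 3))); last lra.
  rewrite ltrD // -(subrKA (xi u1 K%:R)) (le_lt_trans (ler_normD _ _)) //.
  by rewrite ltrD // distrC.
have c0 : 0 <= expR (- (y + d) / eps) by exact: expR_ge0.
apply: le_trans (stationary_mass_ge PhiE_flow eps01 (mu_stationary eps01) (ltW K0) mG c0 hit).
apply: (@le_trans _ _ ((expR (- (y + d) / eps))%:E * (2^-1)%:E)%E); last first.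
  by apply: lee_wpmul2l => //; rewrite lee_fin.
rewrite -EFinM lee_fin ler_pdivlMr // mulrC.
have -> : - (y + d) = - (y + 2 * d) + d by lra.
apply: (@exp_absorbs_factor _ eps d _ 2) => //.
by move: eed; lra.
Qed.

(** Invariance of [m] provides, for almost every symbol, one radius that is good at infinitely many
    integer times in the past; [ldp_lower_at] then applies to each point of [G]. *)
Lemma ldp_lower : {ae m, forall s, exists a, A s = [set a]} ->
  {ae m, forall s, forall G : set H, open G ->
     (- ereal_inf [set quasipotential eqn PhiC A s u | u in G] <=
      limf_einf (log_mass mu s G) 0^'+)%E}.
Proof.
move=> singl.
have tails : {ae m, forall s, exists r1 : R, forall N, exists2 K : nat, (N <= K)%N &
    (tail_rate mu r1 (beta (- K%:R) s) < (-1)%:E)%E}.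
  apply: ae_of_large => theta th0.
  have [r [E [mE Eth EP]]] := tight_radius h6 (-1) th0.
  pose B n := beta (- n%:R) @^-1` E.
  have mB n : measurable (B n) by exact: (measurable_beta_preimage beta_ergodic).
  have Bth n : (m (~` B n) <= theta%:E)%E.
    rewrite /B preimage_setC (beta_mass beta_ergodic) //; exact: measurableC.
  exists (lim_sup_set B); split.
  - by apply: bigcapT_measurable => n; apply: bigcup_measurable => k _; exact: mB.
  - exact: frequently_large.
  have := ae_foralln (fun n : nat => ae_beta beta_ergodic (- n%:R) EP).
  apply: filterS => s sE sB; exists r%:R => N.
  by have [K /= NK BK] := sB N I; exists K => //; exact: sE.
have ae1 := ae_foralln (fun n : nat => ae_beta beta_ergodic (- n%:R) singl).
have ae2 := ae_foralln (fun n : nat => ae_beta beta_ergodic (- n%:R) h1).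
apply: filterS3 tails ae1 ae2 => s [r1 tr] /choice[a aE] att G oG.
rewrite leeNl; apply/ereal_infP => _ [ustar Gu <-].
rewrite leeNl leNgt; apply/negP => /ereal_between[z /andP[Iz zE]].
rewrite lteNr -EFinN in zE.
have [y /andP[Ey yz]] := ereal_between zE.
rewrite lte_fin in yz.
have d0 : 0 < (- z - y) / 2 by rewrite divr_gt0 // subr_gt0.
move: Iz; rewrite ltNge => /negP; apply.
have -> : z = - (y + 2 * ((- z - y) / 2)) by lra.
apply: (ldp_lower_at oG Gu d0 tr _ aE _ Ey).
- by move=> n t t0; have [_ inv _] := att n; exact: inv.
- by move=> n; have [_ _ at_n] := att n; exact: pullback_attracts.
Qed.

End LargeDeviations.

Theorem theorem3p3
    (R : realType)
    (H : completeNormedModType R) (ip : H -> H -> R)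
    (ip_H : inner_product ip) (sep_H : separable H)
    (dS : measure_display) (S : measurableType dS) (m : probability S R)
    (std_S : standard_borel R S)
    (dO : measure_display) (Om : measurableType dO) (P : probability Om R)
    (W : R -> H -> Om -> R) (W_wiener : cylindrical_wiener P ip W)
    (eqn : equation H S)
    (beta_ergodic : ergodic_flow m (flow eqn))
    (test_dense : dense (test eqn))
    (noise_hs : noise_HS m ip eqn)
    (Phi : R -> S -> H -> H) (Phi_flow : deterministic_flow ip eqn Phi)
    (PhiC : (R -> H) -> R -> S -> H -> H)
    (PhiC_flow : controlled_flow ip eqn PhiC)
    (PhiE : R -> R -> S -> H -> Om -> H)
    (PhiE_flow : stochastic_flow P ip W eqn PhiE)
    (A : S -> set H) (mu : R -> S -> probability (borel H) R)
    (h1 : pullback_attractor m eqn Phi A)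
    (h2 : forall eps, 0 < eps <= 1 -> unique_stationary m P eqn PhiE eps (mu eps))
    (h2' : forall (T : R) (s : S), 0 < T -> uniform_LDP P PhiC PhiE s T)
    (h3 : compact_sublevels m eqn PhiC A)
    (h4 : tracking m eqn PhiC A)
    (h5 : escaping_energy m eqn Phi PhiC)
    (h6 : weak_exponential_tightness m mu) :
  {ae m, forall s, forall F : set H, closed F ->
     (limf_esup (log_mass mu s F) 0^'+ <=
      - ereal_inf [set quasipotential eqn PhiC A s u | u in F])%E} /\
  ({ae m, forall s, exists a, A s = [set a]} ->
   {ae m, forall s, forall G : set H, open G ->
     (- ereal_inf [set quasipotential eqn PhiC A s u | u in G] <=
      limf_einf (log_mass mu s G) 0^'+)%E}).
Proof.
have mu_stationary eps : 0 < eps <= 1 -> stationary P eqn PhiE eps (mu eps).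
  by case/h2.
split.
- exact: (ldp_upper sep_H beta_ergodic Phi_flow PhiC_flow PhiE_flow mu_stationary
    h2' h1 h6 h3 h4 h5).
- exact: (ldp_lower ip_H sep_H beta_ergodic Phi_flow PhiC_flow PhiE_flow mu_stationary
    h2' h1 h6).
Qed.
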